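(* Let $n\ge1$, $p\ge1$, $p^{-1}+q^{-1}=1$, $t\in(0,1)$, and $\bar\alpha=(\alpha_1,\dots,\alpha_{n+1})$ with $\alpha_i\in(0,1]$ for all $i=1,\dots,n$ and $\alpha_{n+1}\in[-\infty,\infty]$. Suppose that $f,g,h:(\mathbb{R}_+)^n\to\mathbb{R}_+$ are bounded integrable functions having bounded support that satisfy $$h\left(M_{p,\alpha_1}^{(t,\lambda)}(x_1,y_1),\dots,M_{p,\alpha_n}^{(t,\lambda)}(x_n,y_n)\right)\ge M_{p,\alpha_{n+1}}^{(t,\lambda)}\big(f(x_1,\dots,x_n),g(y_1,\dots,y_n)\big)$$ for all $x=(x_1,\dots,x_n),\,y=(y_1,\dots,y_n)\in(\mathbb{R}_+)^n$ such that $f(x)g(y)>0$ and for all $\lambda\in(0,1)$. Put $\gamma=\left(\sum_{i=1}^{n+1}\alpha_i^{-1}\right)^{-1}$. Then, if $\alpha_{n+1}\ge-\left(\sum_{i=1}^n\alpha_i^{-1}\right)^{-1}$, $$\int_{(\mathbb{R}_+)^n}h(x)\,dx\ \ge\ M_{p\gamma}^t\left(\int_{(\mathbb{R}_+)^n}f(x)\,dx,\int_{(\mathbb{R}_+)^n}g(x)\,dx\right),$$ and if $\alpha_{n+1}<-\left(\sum_{i=1}^n\alpha_i^{-1}\right)^{-1}$, $$\int_{(\mathbb{R}_+)^n}h(x)\,dx\ \ge\ \sup_{0<\lambda<1}\min\left\{[C_{p,\lambda,t}]^{1/\gamma}\int_{(\mathbb{R}_+)^n}f(x)\,dx,\ 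[D_{p,\lambda,t}]^{1/\gamma}\int_{(\mathbb{R}_+)^n}g(x)\,dx\right\}.$$
   Context: $\mathbb{R}_+=[0,\infty)$. Means: for $a,b\ge0$, $t\in[0,1]$, $\alpha\in[-\infty,\infty]$, if $ab>0$ then $M_\alpha^t(a,b)=[(1-t)a^\alpha+tb^\alpha]^{1/\alpha}$ for $\alpha\ne0,\pm\infty$, $a^{1-t}b^t$ for $\alpha=0$, $\max\{a,b\}$ for $\alpha=+\infty$, $\min\{a,b\}$ for $\alpha=-\infty$; and $M_\alpha^t(a,b)=0$ if $ab=0$. $L_p$ coefficients: with $p^{-1}+q^{-1}=1$ ($1/q=0$ when $p=1$) and $t,\lambda\in(0,1)$, $C_{p,\lambda,t}=(1-t)^{1/p}(1-\lambda)^{1/q}$, $D_{p,\lambda,t}=t^{1/p}\lambda^{1/q}$. For $a,b\ge 0$ with $ab>0$, $M_{p,\alpha}^{(t,\lambda)}(a,b)=[C_{p,\lambda,t}a^\alpha+D_{p,\lambda,t}b^\alpha]^{1/\alpha}$ for $\alpha\neq0,\pm\infty$, $a^{C_{p,\lambda,t}}b^{D_{p,\lambda,t}}$ for $\alpha=0$, $\max\{a,b\}$ for $\alpha=+\infty$, $\min\{a,b\}$ for $\alpha=-\infty$; and it equals $0$ if $ab=0$. Degenerate exponents are read by continuity: $1/(\pm\infty)=0$; $\gamma=0$ if $\alpha_{n+1}=0$; $\gamma=-\infty$ if $\sum_{i=1}^{n+1}\alpha_i^{-1}=0$. *)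

(* Defs.v *)
From HB Require Import structures.
From mathcomp Require Import all_boot all_order all_algebra.
From mathcomp Require Import all_classical all_reals all_analysis.
Set Implicit Arguments.
Unset Strict Implicit.
Unset Printing Implicit Defensive.
Import Order.TTheory GRing.Theory Num.Theory.
Import numFieldNormedType.Exports.
Local Open Scope classical_set_scope.
Local Open Scope ring_scope.

(* Lebesgue measure on R^n, with R^n represented by [n.-tuple (measurableTypeR R)].
   The Borel measure is the iterated product of the one-dimensional Lebesgue
   measure, carried from R * R^n to R^(n+1) by [cons]. *)
Section cons_product.
Context {R : realType} (n : nat).

Definition tuple_cons (z : measurableTypeR R * n.-tuple (measurableTypeR R)) :
  n.+1.-tuple (measurableTypeR R) := [tuple of z.1 :: z.2].

Lemma measurable_tuple_cons : measurable_fun [set: _] tuple_cons.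
Proof. exact: measurable_cons. Qed.

Variable m : {sigma_finite_measure set (n.-tuple (measurableTypeR R)) -> \bar R}.

Definition cons_product : set (n.+1.-tuple (measurableTypeR R)) -> \bar R :=
  pushforward (lebesgue_measure \x m)%E tuple_cons.

Let cons_product0 : cons_product set0 = 0%E.
Proof. by rewrite /cons_product /pushforward preimage_set0 measure0. Qed.

Let cons_product_ge0 A : (0 <= cons_product A)%E.
Proof. by rewrite /cons_product /pushforward measure_ge0. Qed.

Let measurable_preimage_cons (A : set (n.+1.-tuple (measurableTypeR R))) :
  measurable A -> measurable (tuple_cons @^-1` A).
Proof. by move=> mA; rewrite -[X in measurable X]setTI; exact: measurable_tuple_cons. Qed.

Let cons_product_sigma_additive : semi_sigma_additive cons_product.
Proof.
move=> F mF tF mUF; rewrite /cons_product /pushforward preimage_bigcup.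
apply: measure_semi_sigma_additive.
- by move=> k; exact: measurable_preimage_cons.
- apply/trivIsetP => /= i j _ _ ij; rewrite -preimage_setI.
  by move/trivIsetP : tF => /(_ _ _ _ _ ij) ->//; rewrite preimage_set0.
- by rewrite -preimage_bigcup; exact: measurable_preimage_cons.
Qed.

HB.instance Definition _ := isMeasure.Build _ _ _ cons_product
  cons_product0 cons_product_ge0 cons_product_sigma_additive.

Let tuple_uncons (x : n.+1.-tuple (measurableTypeR R)) :
  measurableTypeR R * n.-tuple (measurableTypeR R) :=
  (tnth x ord0, [tuple of behead x]).

Let measurable_tuple_uncons : measurable_fun [set: _] tuple_uncons.
Proof.
by apply: measurable_fun_pair; [exact: measurable_tnth|exact: measurable_behead].
Qed.

Let tuple_consK : cancel tuple_cons tuple_uncons.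
Proof. by case=> a y; congr pair; apply/val_inj. Qed.

Let cons_product_sigma_finite : sigma_finite setT cons_product.
Proof.
have /sigma_finiteP[F [TF ndF Foo]] :=
  sigma_finiteT (@lebesgue_measure R : {sigma_finite_measure set _ -> \bar R}).
have /sigma_finiteP[G [TG ndG Goo]] := sigma_finiteT m.
exists (fun k => tuple_uncons @^-1` (F k `*` G k)).
  rewrite -preimage_bigcup (_ : \bigcup_k _ = setT) ?preimage_setT//.
  rewrite -subTset => -[x y] _.
  have [i _ Fix] : (\bigcup_k F k) x by rewrite -TF.
  have [j _ Gjy] : (\bigcup_k G k) y by rewrite -TG.
  exists (maxn i j) => //; split.
  - by move: x Fix; exact/subsetPset/ndF/leq_maxl.
  - by move: y Gjy; exact/subsetPset/ndG/leq_maxr.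
move=> k; have [mF Fky] := Foo k; have [mG Gky] := Goo k; split.
  rewrite -[X in measurable X]setTI; apply: measurable_tuple_uncons => //.
  exact: measurableX.
rewrite /cons_product /pushforward -comp_preimage.
rewrite (_ : tuple_uncons \o tuple_cons = id); last exact/funext/tuple_consK.
by rewrite preimage_id product_measure1E// lte_mul_pinfty// ge0_fin_numE.
Qed.

HB.instance Definition _ := Measure_isSigmaFinite.Build _ _ _ cons_product
  cons_product_sigma_finite.

End cons_product.

Fixpoint borel_lebesgue (R : realType) (n : nat) :
    {sigma_finite_measure set (n.-tuple (measurableTypeR R)) -> \bar R} :=
  match n with
  | 0 => \d_([tuple] : 0.-tuple (measurableTypeR R))
  | n'.+1 => cons_product (borel_lebesgue R n')
  end.

(* Its completion: the measurable sets are the Lebesgue measurable ones. *)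
Definition lebesgue (R : realType) (n : nat) :=
  @completed_measure_extension _ _ _ (borel_lebesgue R n).
Arguments lebesgue : clear implicits.
HB.instance Definition _ (R : realType) (n : nat) :=
  Measure.on (lebesgue R n).

Definition orthant (R : realType) (n : nat) : set (n.-tuple R) :=
  [set x | forall i, 0 <= tnth x i].
Arguments orthant : clear implicits.

(* Boundedness of the support is taken inside the orthant. *)
Definition has_bounded_support (R : realType) (n : nat) (f : n.-tuple R -> R) :=
  exists B : R, forall x, orthant R n x -> f x != 0 -> forall i, tnth x i <= B.

(* Power mean with arbitrary weights [c], [d], for [a, b >= 0]. *)
Definition power_mean (R : realType) (c d : R) (alpha : \bar R) (a b : R) : R :=
  if 0 < a * b then
    match alpha with
    | r%:E => if r == 0 then a `^ c * b `^ d
              else (c * a `^ r + d * b `^ r) `^ r^-1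
    | +oo%E => Num.max a b
    | -oo%E => Num.min a b
    end
  else 0.

Definition mean (R : realType) (t : R) : \bar R -> R -> R -> R :=
  power_mean (1 - t) t.

(* [fine q^-1] is 1/q, with 1/q = 0 for p = 1 (then q = +oo). *)
Definition Lp_C (R : realType) (p l t : R) : R :=
  let q := hoelder_conjugate p%:E in
  (1 - t) `^ p^-1 * (1 - l) `^ fine q^-1.

Definition Lp_D (R : realType) (p l t : R) : R :=
  let q := hoelder_conjugate p%:E in
  t `^ p^-1 * l `^ fine q^-1.

Definition Lp_mean (R : realType) (p t l : R) : \bar R -> R -> R -> R :=
  power_mean (Lp_C p l t) (Lp_D p l t).

(* Reciprocal with 1/(+oo) = 1/(-oo) = 0; the library's [x^-1] on [\bar R]
   sends -oo to -oo instead. Only used at nonzero arguments. *)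
Definition recip (R : realType) (x : \bar R) : R :=
  if x is r%:E then r^-1 else 0.

(* gamma for the exponents (alpha_1, ..., alpha_n, beta), beta = alpha_{n+1}. *)
Definition gamma (R : realType) (n : nat) (alpha : 'I_n -> R) (beta : \bar R) :
    \bar R :=
  let s := \sum_(i < n) (alpha i)^-1 + recip beta in
  if beta == 0%E then 0%E else if s == 0 then -oo%E else s^-1%:E.

(* Main.v *)
From HB Require Import structures.
Require Import Defs.
From mathcomp Require Import all_boot all_order all_algebra.
From mathcomp Require Import all_classical all_reals all_analysis.
From mathcomp Require Import measurable_realfun.
From mathcomp Require Import ring lra.
Set Implicit Arguments.
Unset Strict Implicit.
Unset Printing Implicit Defensive.
Import Order.TTheory GRing.Theory Num.Theory.
Import numFieldNormedType.Exports.
Local Open Scope classical_set_scope.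
Local Open Scope ring_scope.

(** Fix [l] and write [C], [D] for the two Lp coefficients, [N] for the power mean
of exponent [beta] with weights [C], [D], and [S] for the sum of the
[1 / alpha i].  Only two properties of [N] matter: it is nonnegative and
superhomogeneous (monotone and homogeneous of degree 1).  The proof avoids any
bookkeeping of exponents while coordinates are integrated out, by recording all
lower bounds available after a total exponent [s] has been spent: [k] is
admissible at stage [s] for [(X, Y)] when
[k <= N (X u^-s) (Y v^-s) (C u + D v)^s] for all [u, v > 0].
At stage 0 this says [k <= N X Y], so the hypothesis on [f, g, h] reads: each
value admissible at stage 0 for [(f x, g y)] bounds [h] from below at the
coordinatewise mean.  Two instances of Hoelder's inequality
([powR_hoelder], used through [admissible_split]) let stages be composed.

One coordinate with exponent [alpha = 1 / a] raises the stage by [a]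
([admissible_integral_line]).  After the substitution [x = u^a], with Jacobian
[a u^(a-1)] bounded near 0 because [alpha <= 1], the mean of the points becomes
the linear map [C u + D v].  Both functions are divided by their suprema, so
that for each level in [(0, 1)] the superlevel sets are nonempty; the
one-dimensional Brunn-Minkowski inequality applied level by level and the layer
cake formula then give [C \int F + D \int G <= \int K], which is linear in the
integrals.  The factor [a u^(a-1)] accounts for [a - 1] units of the stage, the
factor [C \int F + D \int G] for the last one.

Fubini and induction on [n] bring the stage to [S] for Borel functions
([admissible_integral_tuple]).  Lebesgue measurable functions are Borel off a
Borel null set; putting [f] and [g] to 0 and [h] to [+oo] there keeps the
hypothesis and the integrals ([admissible_integral_lebesgue]).

It remains to find good values that are admissible at stage [S].  For
[beta >= - 1 / S] the mean of exponent [gamma] is one, by Hoelder or by the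
inequality between weighted arithmetic and geometric means; below that
threshold only the minimum in the second conclusion is.  In the first regime
[l] is chosen so that Hoelder's inequality between the Lp coefficients and the
powers [If ^ gamma], [Ig ^ gamma] is an equality
([Lp_coefficients_optimal]), which turns the mean of exponent [gamma] into the
one of exponent [p gamma]; for [gamma = 0] or [gamma = -oo] the choice [l = t]
gives the weights [1 - t] and [t]. *)

(** * A two-point Hoelder inequality and admissible values *)

Section two_point_hoelder.
Context {R : realType}.
Implicit Types x y p q u v w s b C D th k m r : R.

(** Apply [ln z <= z - 1] to [x] and [y] divided by their arithmetic mean, and take
the weighted sum. *)
Lemma powR_amgm x y C D : 0 < x -> 0 < y -> 0 <= C -> 0 <= D -> C + D = 1 ->
  x `^ C * y `^ D <= C * x + D * y.
Proof.
move=> x0 y0 C0 D0 CD.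
have m0 : 0 < C * x + D * y.
  have [C00|Cn] := eqVneq C 0.
    by rewrite C00 mul0r add0r (_ : D = 1) ?mul1r//; lra.
  apply: ltr_pwDl; first by rewrite mulr_gt0// lt_def Cn.
  by rewrite mulr_ge0// ltW.
set m := C * x + D * y in m0 *.
have ln_le z : 0 < z -> ln z <= ln m + (z / m - 1).
  move=> z0; have : ln (1 + (z / m - 1)) <= z / m - 1.
    by apply: le_ln1Dx; rewrite ltrBDl subrr divr_gt0.
  rewrite addrC subrK ln_div ?posrE//; lra.
rewrite -ler_ln ?posrE ?mulr_gt0 ?powR_gt0//.
rewrite lnM ?posrE ?powR_gt0// !ln_powR.
have := ler_wpM2l C0 (ln_le _ x0); have := ler_wpM2l D0 (ln_le _ y0).
move=> h1 h2; apply: le_trans (lerD h2 h1) _.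
have -> : C * (ln m + (x / m - 1)) + D * (ln m + (y / m - 1)) =
  (C + D) * (ln m - 1) + (C * x + D * y) / m by ring.
rewrite -/m; by rewrite divff ?gt_eqF// CD; lra.
Qed.

(** Weighted arithmetic-geometric mean inequality for the normalized pairs
[(p / P, u / U)] and [(q / P, v / U)], where [P] and [U] are the two sums on the
right-hand side; their weighted sum is 1. *)
Lemma powR_hoelder p q u v C D k s : 0 < p -> 0 < q -> 0 < u -> 0 < v ->
  0 < C -> 0 < D -> 0 <= k -> 0 <= s -> 0 < k + s ->
  (C * (p `^ (k / (k + s)) * u `^ (s / (k + s))) +
   D * (q `^ (k / (k + s)) * v `^ (s / (k + s)))) `^ (k + s) <=
  (C * p + D * q) `^ k * (C * u + D * v) `^ s.
Proof.
move=> p0 q0 u0 v0 C0 D0 k0 s0 ks0.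
set th := k / (k + s); set et := s / (k + s).
have th0 : 0 <= th by rewrite divr_ge0// ltW.
have et0 : 0 <= et by rewrite divr_ge0// ltW.
have thet : th + et = 1 by rewrite -mulrDl divff// gt_eqF.
have P0 : 0 < C * p + D * q by rewrite addr_gt0// mulr_gt0.
have U0 : 0 < C * u + D * v by rewrite addr_gt0// mulr_gt0.
set P := C * p + D * q in P0 *; set U := C * u + D * v in U0 *.
have Ppow : P `^ k * U `^ s = (P `^ th * U `^ et) `^ (k + s).
  rewrite powRM ?powR_ge0// -!powRrM /th /et !divfK ?gt_eqF//.
rewrite Ppow ge0_ler_powR ?nnegrE ?mulr_ge0 ?powR_ge0 ?(ltW ks0)//.
  by rewrite addr_ge0// mulr_ge0 ?(ltW C0) ?(ltW D0)// mulr_ge0 ?powR_ge0.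
have PU0 : 0 < P `^ th * U `^ et by rewrite mulr_gt0 ?powR_gt0.
rewrite -[leRHS]mul1r -ler_pdivrMr// mulrDl.
have E x y : 0 < x -> 0 < y -> x `^ th * y `^ et / (P `^ th * U `^ et) <=
    th * (x / P) + et * (y / U).
  move=> x0 y0; rewrite ler_pdivrMr//.
  have -> : x `^ th * y `^ et =
      ((x / P) `^ th * (y / U) `^ et) * (P `^ th * U `^ et).
    by rewrite mulrACA -!powRM ?divr_ge0 ?(ltW P0) ?(ltW U0) ?ltW// !divfK ?gt_eqF.
  by rewrite ler_pM2r//; apply: powR_amgm => //; rewrite divr_gt0.
apply: (@le_trans _ _ (C * (th * (p / P) + et * (u / U)) +
                       D * (th * (q / P) + et * (v / U)))).
  by apply: lerD; rewrite -(mulrA _ (_ * _)) ler_pM2l//; exact: E.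
have -> : C * (th * (p / P) + et * (u / U)) + D * (th * (q / P) + et * (v / U)) =
   th * ((C * p + D * q) / P) + et * ((C * u + D * v) / U) by ring.
by rewrite -/P -/U !divff ?gt_eqF// !mulr1 thet.
Qed.

End two_point_hoelder.

Section admissible.
Context {R : realType}.
Variables (C D : R) (N : R -> R -> R).
Implicit Types s b X Y k u v w m : R.
Hypotheses (C0 : 0 < C) (D0 : 0 < D).

(** Monotonicity and homogeneity of degree 1 in one condition. *)
Definition superhomogeneous := forall m X Y X' Y', 0 < m -> 0 < X -> 0 < Y ->
  m * X <= X' -> m * Y <= Y' -> m * N X Y <= N X' Y'.

(** The values [k] that can serve as a lower bound once the total exponent [s]
has been integrated out; the largest one is the infimum over [u] and [v], which
never has to be computed. *)
Definition admissible s X Y k := forall u v, 0 < u -> 0 < v ->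
  k <= N (X * u `^ (- s)) (Y * v `^ (- s)) * (C * u + D * v) `^ s.

Lemma admissible_scale s m X Y X' Y' k : superhomogeneous ->
  0 < m -> 0 < X -> 0 < Y -> m * X <= X' -> m * Y <= Y' ->
  admissible s X Y k -> admissible s X' Y' (m * k).
Proof.
move=> Nhom m0 X0 Y0 XX' YY' adm u v u0 v0.
apply: (@le_trans _ _ (m * (N (X * u `^ (- s)) (Y * v `^ (- s)) *
                            (C * u + D * v) `^ s))).
  by rewrite ler_pM2l// adm.
rewrite mulrA ler_wpM2r ?powR_ge0//.
by apply: Nhom; rewrite ?mulr_gt0 ?powR_gt0// mulrA ler_wpM2r ?powR_ge0.
Qed.

Hypothesis N0 : forall X Y, 0 < X -> 0 < Y -> 0 <= N X Y.

(** Stages compose: testing the hypothesis at the geometric means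
[p^(s/(s+b)) u^(b/(s+b))] and [q^(s/(s+b)) v^(b/(s+b))] of two pairs of test
points loses nothing, by Hoelder's inequality. *)
Lemma admissible_split s b X Y k u v : 0 <= s -> 0 <= b -> 0 < X -> 0 < Y ->
  0 < u -> 0 < v -> admissible (s + b) X Y k ->
  admissible s (X * u `^ (- b)) (Y * v `^ (- b)) (k / (C * u + D * v) `^ b).
Proof.
move=> s0 b0 X0 Y0 u0 v0 adm p q p0 q0.
have CD0 : 0 < C * u + D * v by rewrite addr_gt0// mulr_gt0.
rewrite ler_pdivrMr ?powR_gt0//.
have [sb0|] := eqVneq (s + b) 0.
  have s0' : s = 0 by lra.
  have b0' : b = 0 by lra.
  move: adm; rewrite s0' b0' addr0 => /(_ 1 1 ltr01 ltr01).
  by rewrite !oppr0 !powRr0 !mulr1.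
move=> sb0; have {}sb0 : 0 < s + b by rewrite lt_def sb0 addr_ge0.
have Epow x y : (x `^ (s / (s + b)) * y `^ (b / (s + b))) `^ (- (s + b)) =
    x `^ (- s) * y `^ (- b).
  rewrite powRM ?powR_ge0// -!powRrM !mulrN !divfK ?gt_eqF//.
have /adm : 0 < p `^ (s / (s + b)) * u `^ (b / (s + b)).
  by rewrite mulr_gt0 ?powR_gt0.
move=> /(_ (q `^ (s / (s + b)) * v `^ (b / (s + b)))).
rewrite !mulr_gt0 ?powR_gt0// => /(_ isT); rewrite !Epow => /le_trans; apply.
rewrite (mulrAC X) (mulrAC Y) -(mulrA X) -(mulrA Y) -[leRHS]mulrA ler_wpM2l//.
  by apply: N0; rewrite ?mulr_gt0 ?powR_gt0.
exact: powR_hoelder.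
Qed.

End admissible.

(** * Layer cake formula *)

Section layer_cake.
Context d (T : measurableType d) (R : realType).
Variable m : {sigma_finite_measure set T -> \bar R}.
Local Open Scope ereal_scope.

(** Fubini for [w t] times the indicator of [0 < z < f t].  The weight is
meant to be the Jacobian of a substitution. *)
Lemma weighted_layer_cake (w f : T -> \bar R) :
  measurable_fun [set: T] w -> measurable_fun [set: T] f ->
  (forall t, 0 <= w t) -> (forall t, 0 <= f t) ->
  \int[m]_t (w t * f t) =
  \int[lebesgue_measure]_(z in `]0%R, +oo[) \int[m]_(t in [set t | (z : R)%:E < f t]) w t.
Proof.
move=> mw mf w0 f0.
pose S : set (T * measurableTypeR R) :=
  [set tz | tz.2 \in `]0%R, +oo[%R /\ tz.2%:E < f tz.1].
have mS : measurable S.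
  rewrite (_ : S = (setT `*` `]0%R, +oo[%classic) `&`
                   [set tz | (tz.2)%:E < f tz.1]); last first.
    by apply/seteqP; split=> [[t z] [/= a b]|[t z] [[_ /= a] b]].
  apply: measurable_lte.
  - by apply: measurableX.
  - apply/measurable_funTS/measurable_EFinP; exact: measurable_snd.
  - by apply/measurable_funTS; apply: (measurableT_comp mf); exact: measurable_fst.
pose G (tz : T * measurableTypeR R) := (w tz.1 * (\1_S tz)%:E)%E.
have mG : measurable_fun setT G.
  apply: emeasurable_funM.
    by apply: (measurableT_comp mw); exact: measurable_fst.
  by apply/measurable_EFinP; exact: measurable_indic.
have G0 tz : 0 <= G tz by rewrite mule_ge0// lee_fin.
transitivity (\int[m]_t \int[lebesgue_measure]_z G (t, z)).
  apply: eq_integral => t _.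
  pose St : set (measurableTypeR R) := [set z | z \in `]0%R, +oo[%R /\ z%:E < f t].
  pose i : interval R := Interval (BRight 0%R) (if f t is r%:E then BLeft r else +oo%O).
  have StE : St = [set` i].
    apply/seteqP; split=> z; rewrite /St /i /= !in_itv/=; have := f0 t;
      case: (f t) => [r| |] //= _; rewrite ?andbT.
    - by rewrite lte_fin => -[-> ->].
    - by case.
    - by rewrite lte_fin => /andP.
    - by move=> ->; rewrite ltry.
  have mSt : measurable St by rewrite StE; exact: measurable_itv.
  transitivity (\int[lebesgue_measure]_z (w t * (\1_St z)%:E)); last first.
    by apply: eq_integral => z _; rewrite /G /= !indicE.
  transitivity (w t * \int[lebesgue_measure]_z (EFin \o \1_St) z); last first.
    rewrite -ge0_integralZl//; last by move=> z _; rewrite lee_fin.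
    by apply/measurable_EFinP; exact: measurable_indic.
  have lSt : lebesgue_measure St = f t.
    have -> : lebesgue_measure St = lebesgue_measure [set` i] by rewrite StE.
    rewrite lebesgue_measure_itv /i.
    have := f0 t; case: (f t) => [r| |] //=.
    - rewrite lee_fin le_eqVlt lte_fin => /predU1P[r0|r0].
        by rewrite -r0 ltxx.
      by rewrite r0 -EFinD subr0.
    - by rewrite ltry.
  by congr (_ * _); rewrite integral_indic// setIT; exact/esym.
rewrite (fubini_tonelli G)//.
rewrite [RHS]integral_mkcond; apply: eq_integral => z _.
rewrite patchE; case: ifPn => [/set_mem zpos|zneg].
- rewrite [RHS]integral_mkcond; apply: eq_integral => t _; rewrite /G/= patchE indicE.
  case: ifPn => [/set_mem/= fz|/negP fz].
    by rewrite (_ : _ \in S) ?mule1// inE.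
  rewrite (_ : (_ \in S) = false) ?mule0//; apply/negbTE/negP => /set_mem [_ /= h].
  by apply: fz; rewrite inE.
- apply: integral0_eq => t _; rewrite /G indicE (_ : (_ \in S) = false) ?mule0//.
  by apply/negbTE/negP => /set_mem [/= h _]; move/negP: zneg; apply; rewrite inE.
Qed.

Lemma layer_cake (f : T -> \bar R) :
  measurable_fun [set: T] f -> (forall t, 0 <= f t) ->
  \int[m]_t f t =
  \int[lebesgue_measure]_(z in `]0%R, +oo[) m [set t | (z : R)%:E < f t].
Proof.
move=> mf f0.
transitivity (\int[m]_t (cst 1 t * f t)); first by under [RHS]eq_integral do rewrite mul1e.
rewrite weighted_layer_cake//.
apply: eq_integral => z _; rewrite integral_cst ?mul1e//.
by rewrite -[X in measurable X]setTI; exact: emeasurable_fun_o_infty.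
Qed.

End layer_cake.

(** * The line: affine images and the substitution x = u ^ a *)

Section density_measure.
Context d (T : measurableType d) (R : realType).
Variables (m : {measure set T -> \bar R}) (w : T -> \bar R).
Hypotheses (mw : measurable_fun [set: T] w) (w0 : forall t, (0 <= w t)%E).
Local Open Scope ereal_scope.

Definition density of measurable_fun [set: T] w & (forall t, 0 <= w t) :=
  fun A : set T => \int[m]_(t in A) w t.

Local Notation nu := (density mw w0).

Let density0 : nu set0 = 0.
Proof. by rewrite /density integral_set0. Qed.

Let density_ge0 A : 0 <= nu A.
Proof. by rewrite /density integral_ge0. Qed.

Let density_sigma_additive : semi_sigma_additive nu.
Proof.
move=> /= F mF tF mUF; rewrite /density; apply: cvg_toP.
  apply: ereal_nondecreasing_is_cvgn => a b ab.
  by apply: lee_sum_nneg_natr => // k _ _; apply: integral_ge0.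
by rewrite ge0_integral_bigcup//; exact: measurable_funTS.
Qed.

HB.instance Definition _ := isMeasure.Build _ _ _ nu
  density0 density_ge0 density_sigma_additive.

End density_measure.

Section line_substitution.
Context {R : realType}.
Local Notation mu := (@lebesgue_measure R).
Implicit Types (A : set R) (a b c u x : R).

(** Uniqueness of Lebesgue measure: the pushforward along the affine map, rescaled,
agrees with it on half-open intervals. *)
Lemma lebesgue_measure_affine C c A : 0 < C -> measurable A ->
  mu [set x | A ((x - c) / C)] = (C%:E * mu A)%E.
Proof.
move=> C0 mA.
pose phi x : measurableTypeR R := (x - c) / C.
have mphi : measurable_fun setT (phi : measurableTypeR R -> _).
  by apply: measurable_funM => //; exact: measurable_funB.
have Ci0 : 0 <= C^-1 by rewrite invr_ge0 ltW.
pose nu :=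
   mscale (NngNum Ci0) (pushforward mu phi) : {measure set (measurableTypeR R) -> \bar R}.
have E : mu A = nu mphi A.
  apply: lebesgue_measure_unique => // _ [[p q] _ <-] /=.
  rewrite /nu /mscale /= /pushforward.
  rewrite (_ : phi @^-1` _ = `]C * p + c, C * q + c]%classic); last first.
    apply/seteqP; split=> x; rewrite /= !in_itv/= /phi ltr_pdivlMr// ler_pdivrMr//;
    by rewrite ltrBrDr lerBlDr ![C * _]mulrC.
  rewrite !lebesgue_measure_itv/= !lte_fin ltrD2r ltr_pM2l//.
  case: ifPn => _; last by rewrite mule0.
  by rewrite -!EFinD -EFinM; congr EFin; rewrite opprD addrACA subrr addr0 -mulrBr mulKf// gt_eqF.
by rewrite E /nu /mscale/= muleA -EFinM divff ?gt_eqF// mul1e.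
Qed.


Lemma powR_continuous r b : 0 < b -> {for b, continuous (@powR R ^~ r)}.
Proof.
move=> b0; apply/differentiable_continuous/derivable1_diffP.
by apply: derivable_powR; rewrite in_itv/= b0.
Qed.

Lemma powR_cvg_right r b : 0 <= r -> 0 <= b ->
  x `^ r @[x --> b^'+] --> b `^ r.
Proof.
move=> r0; rewrite le_eqVlt => /predU1P[<-|b0].
  have [->|rn] := eqVneq r 0.
    rewrite powRr0 (_ : (fun x => x `^ 0) = cst 1); first exact: cvg_cst.
    by apply/funext => x; rewrite powRr0.
  by rewrite powR0//; apply: powR_cvg0; rewrite lt_def rn.
by apply: cvg_at_right_filter; exact: powR_continuous.
Qed.

(** The Jacobian of [u |-> u ^ a] on the positive half-line, extended by 0. *)
Definition powR_density a u : \bar R :=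
  (if 0 < u then a * u `^ (a - 1) else 0)%:E.

Lemma measurable_powR_density a : measurable_fun [set: R] (powR_density a).
Proof.
apply/measurable_EFinP; apply: measurable_fun_ifT => //.
  exact: measurable_fun_ltr.
by apply: measurable_funM => //; exact: measurable_powR.
Qed.

Lemma powR_density_ge0 a u : 0 <= a -> (0 <= powR_density a u)%E.
Proof.
by move=> a0; rewrite lee_fin; case: ifP => // _; rewrite mulr_ge0// powR_ge0.
Qed.

Lemma integral_powR_density a b c : 1 <= a -> 0 <= b -> b <= c ->
  (\int[mu]_(u in `]b, c]) powR_density a u = (c `^ a - b `^ a)%:E)%E.
Proof.
move=> a1 b0; rewrite le_eqVlt => /predU1P[<-|bc].
  by rewrite set_itvoc0 integral_set0 subrr.
have a0 : 0 <= a - 1 by rewrite subr_ge0.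
have -> : (\int[mu]_(u in `]b, c]) powR_density a u =
           \int[mu]_(u in `]b, c]) (a * u `^ (a - 1))%:E)%E.
  apply: eq_integral => u; rewrite inE/= in_itv/= => /andP[bu _].
  by rewrite /powR_density (le_lt_trans b0 bu).
rewrite integral_itv_obnd_cbnd; last first.
  by apply/measurable_EFinP/measurable_funTS; apply: measurable_funM => //; exact: measurable_powR.
have c0 : 0 < c := le_lt_trans b0 bc.
rewrite (@continuous_FTC2 _ _ (@powR R ^~ a))// ?EFinB//.
- apply/continuous_within_itvP => //; split.
  + move=> x; rewrite in_itv/= => /andP[bx _].
    by apply: cvgMr; apply: powR_continuous; exact: le_lt_trans bx.
  + by apply: cvgMr; apply: powR_cvg_right.
  + by apply: cvgMr; apply: cvg_at_left_filter; apply: powR_continuous.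
- split.
  + move=> x; rewrite in_itv/= => /andP[bx _].
    by apply: derivable_powR; rewrite in_itv/= (le_lt_trans b0 bx).
  + by apply: powR_cvg_right => //; lra.
  + by apply: cvg_at_left_filter; apply: powR_continuous.
- move=> x; rewrite in_itv/= => /andP[bx _].
  by rewrite powR_derive1// in_itv/= (le_lt_trans b0 bx).
Qed.

(** By uniqueness of Lebesgue measure it suffices to treat half-open intervals,
where the claim is the fundamental theorem of calculus.  The restriction of
Lebesgue measure to the nonpositive half-line is added so as to obtain a measure
on the whole line. *)
Lemma lebesgue_measure_powR a A : 1 <= a -> measurable A -> A `<=` `]0, +oo[ ->
  mu A = (\int[mu]_(u in [set u | A (u `^ a)%R]) powR_density a u)%E.
Proof.
move=> a1 mA A0.
have a0 : 0 < a by lra.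
have da0 u : (0 <= powR_density a u)%E by rewrite powR_density_ge0// ltW.
pose phi u : measurableTypeR R := u `^ a.
have mphi : measurable_fun setT (phi : measurableTypeR R -> _).
  exact: measurable_powR.
pose dn := density mu (measurable_powR_density a) da0.
pose neg : {measure set (measurableTypeR R) -> \bar R} :=
  mrestr mu (measurable_itv `]-oo, 0%R]).
pose pos := pushforward dn phi : {measure set (measurableTypeR R) -> \bar R}.
pose nu : {measure set (measurableTypeR R) -> \bar R} := measure_add neg (pos mphi).
have nuE X : nu X = (neg X + pos mphi X)%E by exact: measure_addE.
have E : mu A = nu A.
  apply: lebesgue_measure_unique => // _ /ocitvP[->|[[p q] /= pq ->]].
    by rewrite !measure0.
  rewrite nuE /= /neg /mrestr /pos /pushforward /dn /density.
  have -> : `]p, q]%classic `&` `]-oo, 0] = `]p, Num.min q 0]%classic.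
    by apply/seteqP; split=> x; rewrite /= !in_itv/= le_min andbA => /andP.
  (* The preimage of the positive part of the interval is again an interval. *)
  pose B := Num.max p 0 `^ a^-1; pose Q := Num.max q 0 `^ a^-1.
  have mp0 : 0 <= Num.max p 0 by rewrite le_max lexx orbT.
  have mq0 : 0 <= Num.max q 0 by rewrite le_max lexx orbT.
  have mpq : Num.max p 0 <= Num.max q 0 by rewrite ge_max !le_max (ltW pq) lexx orbT.
  have ai0 : 0 <= a^-1 by rewrite invr_ge0 ltW.
  have BQ : B <= Q by rewrite ge0_ler_powR.
  have rootK x : 0 <= x -> (x `^ a^-1) `^ a = x.
    by move=> x0; rewrite -powRrM mulVf ?gt_eqF// powRr1.
  have powlt x y : 0 <= x -> 0 <= y -> (x `^ a < y `^ a) = (x < y).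
    move=> x0 y0; apply/idP/idP; last by move=> xy; rewrite gt0_ltr_powR.
    by apply: contraTT; rewrite -!leNgt => yx; rewrite ge0_ler_powR// ltW.
  have powle x y : 0 <= x -> 0 <= y -> (x `^ a <= y `^ a) = (x <= y).
    by move=> x0 y0; rewrite !leNgt powlt.
  have -> : (\int[mu]_(t in phi @^-1` `]p, q]%classic) powR_density a t)%E =
      (\int[mu]_(t in `]B, Q]) powR_density a t)%E.
    rewrite integral_mkcond [RHS]integral_mkcond; apply: eq_integral => u _.
    rewrite !patchE; have [u0|u0] := ltP 0 u; last first.
      by rewrite /powR_density ltNge u0/= !if_same.
    have key : (p < u `^ a <= q) = (B < u <= Q).
      rewrite -(powlt B)// ?powR_ge0 ?(ltW u0)// -(powle u)// ?powR_ge0 ?(ltW u0)//.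
      by rewrite !rootK// gt_max le_max powR_gt0// andbT [_ <= 0]leNgt powR_gt0// orbF.
    by congr (if _ then _ else _); apply/idP/idP;
      rewrite !inE/= !in_itv/= /phi key.
  rewrite integral_powR_density// ?powR_ge0// !rootK//.
  have -> : mu `]p, Num.min q 0]%classic = (Num.min q 0 - Num.min p 0)%:E.
    rewrite lebesgue_measure_itv/= lte_fin lt_min pq/=.
    have [p0|p0] := ltP p 0; first by rewrite EFinB.
    by rewrite min_r ?subrr// (le_trans p0)// ltW.
  rewrite lebesgue_measure_itv/= lte_fin pq -EFinB -EFinD; congr EFin.
  by have [p0|p0] := ltP p 0; have [q0|q0] := ltP q 0; lra.
rewrite E nuE /= /neg /mrestr.
rewrite (_ : A `&` _ = set0); last first.
  apply/seteqP; split=> // x [/A0/=]; rewrite !in_itv/= andbT => x0.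
  by rewrite leNgt x0.
by rewrite measure0 add0e.
Qed.

End line_substitution.

(** * The Brunn-Minkowski inequality on the line *)

Section line_integrals.
Context {R : realType}.
Local Notation mu := (@lebesgue_measure R).
Local Open Scope ereal_scope.

Lemma measurable_superlevel (f : R -> \bar R) : measurable_fun [set: R] f ->
  measurable_fun [set: R] (fun z : R => mu [set t | (z : R)%:E < f t]).
Proof.
move=> mf.
pose S : set (measurableTypeR R * measurableTypeR R) := [set tz | tz.2%:E < f tz.1].
have mS : measurable S.
  rewrite -[X in measurable X]setTI; apply: measurable_lte => //.
  - by apply/measurable_EFinP; exact: measurable_snd.
  - by apply: (measurableT_comp mf); exact: measurable_fst.
have := measurable_fun_ysection mu mS; congr measurable_fun.
apply/funext => z /=; congr (mu _); apply/seteqP.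
by split=> t; rewrite /ysection/= /S inE.
Qed.

Lemma measurable_superlevel_set (f : R -> \bar R) z :
  measurable_fun [set: R] f -> measurable [set t | z < f t].
Proof. by move=> mf; rewrite -[X in measurable X]setTI; exact: emeasurable_fun_o_infty. Qed.

(** Apply the substitution to every superlevel set, then undo the layer cake with
the Jacobian as weight. *)
Lemma ge0_integral_powR a (f : R -> \bar R) : (1 <= a)%R ->
  measurable_fun [set: R] f -> (forall x, 0 <= f x) ->
  \int[mu]_(x in `]0%R, +oo[) f x = \int[mu]_u (powR_density a u * f (u `^ a)%R).
Proof.
move=> a1 mf f0.
have a0 : (0 <= a)%R by rewrite (le_trans _ a1).
have f'0 x : 0 <= (f \_ `]0%R, +oo[) x by rewrite patchE; case: ifP.
have mf' : measurable_fun [set: R] (f \_ `]0%R, +oo[).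
  by apply/(measurable_restrictT _ _).1 => //; exact: measurable_funTS.
have mp : measurable_fun [set: R] (fun u => u `^ a)%R by exact: measurable_powR.
have -> : \int[mu]_u (powR_density a u * f (u `^ a)%R) =
          \int[mu]_u (powR_density a u * (f \_ `]0%R, +oo[) (u `^ a)%R).
  apply: eq_integral => u _; rewrite /powR_density; case: ltP => u0; last first.
    by rewrite !mul0e.
  by rewrite patchE mem_set//= in_itv/= andbT powR_gt0.
rewrite integral_mkcond layer_cake// weighted_layer_cake//; last 3 first.
- exact: measurable_powR_density.
- by apply: (measurableT_comp mf').
- by move=> u; exact: powR_density_ge0.
apply: eq_integral => z; rewrite inE/= in_itv/= andbT => z0.
rewrite (lebesgue_measure_powR a1)//; first exact: measurable_superlevel_set.
move=> x /=; rewrite patchE; case: ifPn => [/set_mem//|_].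
by rewrite lte_fin ltNge (ltW z0).
Qed.

(** With [a] near [sup A] and [b] near [inf B], the translates [C A + D b] and
[C a + D B] lie in [E] and overlap in an interval of length at most [e]. *)
Lemma brunn_minkowski_line (C D : R) (A B E : set R) : (0 < C)%R -> (0 < D)%R ->
  measurable A -> measurable B -> measurable E ->
  A !=set0 -> B !=set0 -> has_ubound A -> has_lbound B ->
  (forall a b, A a -> B b -> E (C * a + D * b)%R) ->
  C%:E * mu A + D%:E * mu B <= mu E.
Proof.
move=> C0 D0 mA mB mE A0 B0 ubA lbB ABE.
apply/lee_addgt0Pr => e e0.
(* The overlap has length at most (C + D) times the distance to the extrema. *)
pose dl : R := (e / (C + D))%R.
have CD0 : (0 < C + D)%R by rewrite addr_gt0.
have dl0 : (0 < dl)%R by rewrite divr_gt0.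
have [a Aa adl] := sup_adherent dl0 (conj A0 ubA).
have [b Bb bdl] := inf_adherent dl0 (conj B0 lbB).
pose E1 : set R := [set x | A ((x - D * b) / C)%R].
pose E2 : set R := [set x | B ((x - C * a) / D)%R].
have mE1 : measurable E1.
  rewrite -[X in measurable X]setTI.
  have : measurable_fun [set: R] (fun x : R => ((x - D * b) / C)%R).
    by apply: measurable_funM => //; exact: measurable_funB.
  exact.
have mE2 : measurable E2.
  rewrite -[X in measurable X]setTI.
  have : measurable_fun [set: R] (fun x : R => ((x - C * a) / D)%R).
    by apply: measurable_funM => //; exact: measurable_funB.
  exact.
have E1E : E1 `<=` E.
  move=> x Ax; have := ABE _ _ Ax Bb.
  by rewrite mulrCA divff ?gt_eqF// mulr1 subrK.
have E2E : E2 `<=` E.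
  move=> x Bx; have := ABE _ _ Aa Bx.
  by rewrite (mulrCA D) divff ?gt_eqF// mulr1 addrC subrK.
have E12 : mu (E2 `&` E1) <= e%:E.
  apply: (@le_trans _ _ (mu `[(C * a + D * inf B)%R, (C * sup A + D * b)%R]%classic)).
    apply: le_measure; rewrite ?inE//; first exact: measurableI.
    move=> x [Bx Ax]; rewrite /= in_itv/=; apply/andP; split.
      have := ge_inf lbB Bx; rewrite ler_pdivlMr// mulrC => h; lra.
    have := ub_le_sup ubA Ax; rewrite ler_pdivrMr// mulrC => h; lra.
  rewrite lebesgue_measure_itv/= lte_fin; case: ifPn => _; last by rewrite lee_fin ltW.
  rewrite -EFinD lee_fin.
  have -> : e = (C * dl + D * dl)%R by rewrite -mulrDl mulrC /dl divfK// gt_eqF.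
  have h1 : (C * (sup A - dl) <= C * a)%R by rewrite ler_pM2l// ltW.
  have h2 : (D * b <= D * (inf B + dl))%R by rewrite ler_pM2l// ltW.
  lra.
rewrite -(lebesgue_measure_affine (D * b) C0 mA) -(lebesgue_measure_affine (C * a) D0 mB).
rewrite -/E1 -/E2 (measureDI mu mE2 mE1) addeA leeD//.
rewrite -measureU//; [|exact: measurableD|by rewrite setDE setICA setICr setI0].
apply: le_measure; rewrite ?inE//; first by apply: measurableU => //; exact: measurableD.
by move=> x [/E1E//|[/E2E]].
Qed.

(** At a level [z < 1] both superlevel sets are nonempty, because 1 is the supremum
of both functions, and that of [K] contains their combination; levels above 1
contribute nothing to the left-hand side. *)
Lemma integral_brunn_minkowski (C D B : R) (F G : R -> R) (K : R -> \bar R) :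
  (0 < C)%R -> (0 < D)%R ->
  measurable_fun [set: R] F -> measurable_fun [set: R] G -> measurable_fun [set: R] K ->
  (forall u, 0 <= F u <= 1)%R -> (forall u, 0 <= G u <= 1)%R -> (forall u, 0 <= K u) ->
  (forall z, (z < 1)%R -> exists u, (z < F u)%R) ->
  (forall z, (z < 1)%R -> exists u, (z < G u)%R) ->
  (forall u, F u != 0%R -> (0 <= u <= B)%R) -> (forall u, G u != 0%R -> (0 <= u <= B)%R) ->
  (forall u v, (0 < F u)%R -> (0 < G v)%R ->
     (Num.min (F u) (G v))%:E <= K (C * u + D * v)%R) ->
  C%:E * (\int[mu]_u (F u)%:E) + D%:E * (\int[mu]_u (G u)%:E) <= \int[mu]_u K u.
Proof.
move=> C0 D0 mF mG mK F01 G01 K0 supF supG sF sG FGK.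
have mF' : measurable_fun [set: R] (EFin \o F) by exact/measurable_EFinP.
have mG' : measurable_fun [set: R] (EFin \o G) by exact/measurable_EFinP.
have F0' u : 0 <= (EFin \o F) u by rewrite lee_fin; case/andP: (F01 u).
have G0' u : 0 <= (EFin \o G) u by rewrite lee_fin; case/andP: (G01 u).
have -> : \int[mu]_u (F u)%:E = _ := layer_cake mu mF' F0'.
have -> : \int[mu]_u (G u)%:E = _ := layer_cake mu mG' G0'.
rewrite (layer_cake mu mK)//.
rewrite -ge0_integralZl//; last 2 first.
- by apply: measurable_funTS; exact: measurable_superlevel.
- by rewrite lee_fin ltW.
rewrite -ge0_integralZl//; last 2 first.
- by apply: measurable_funTS; exact: measurable_superlevel.
- by rewrite lee_fin ltW.
have mlF : measurable_fun [set: R] (fun z : R => C%:E * mu [set t | z%:E < (EFin \o F) t]).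
  by apply: emeasurable_funM => //; exact: measurable_superlevel.
have mlG : measurable_fun [set: R] (fun z : R => D%:E * mu [set t | z%:E < (EFin \o G) t]).
  by apply: emeasurable_funM => //; exact: measurable_superlevel.
rewrite -ge0_integralD//; last 4 first.
- by move=> z _; rewrite mule_ge0// lee_fin ltW.
- exact: measurable_funTS.
- by move=> z _; rewrite mule_ge0// lee_fin ltW.
- exact: measurable_funTS.
apply: ge0_le_integral => //.
- by move=> z _; rewrite adde_ge0// mule_ge0// lee_fin ltW.
- by apply/measurable_funTS/emeasurable_funD.
- by apply: measurable_funTS; exact: measurable_superlevel.
move=> z; rewrite /= in_itv/= andbT => z0.
have [z1|z1] := leP 1%R z.
  rewrite (_ : [set t | z%:E < (F t)%:E] = set0); last first.
    apply/seteqP; split=> // u /=; rewrite lte_fin => zF.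
    by have := F01 u => /andP[_]; rewrite leNgt (le_lt_trans z1).
  rewrite (_ : [set t | z%:E < (G t)%:E] = set0); last first.
    apply/seteqP; split=> // u /=; rewrite lte_fin => zG.
    by have := G01 u => /andP[_]; rewrite leNgt (le_lt_trans z1).
  by rewrite !measure0 !mule0 adde0.
apply: brunn_minkowski_line => //.
- exact: measurable_superlevel_set.
- exact: measurable_superlevel_set.
- exact: measurable_superlevel_set.
- by have [u zu] := supF _ z1; exists u; rewrite /= lte_fin.
- by have [u zu] := supG _ z1; exists u; rewrite /= lte_fin.
- exists B => u /=; rewrite lte_fin => zF.
  by have /sF/andP[] : F u != 0%R by rewrite gt_eqF// (lt_trans z0).
- exists 0%R => u /=; rewrite lte_fin => zG.
  by have /sG/andP[] : G u != 0%R by rewrite gt_eqF// (lt_trans z0).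
- move=> u v /=; rewrite !lte_fin => zF zG.
  apply: lt_le_trans (FGK _ _ (lt_trans z0 zF) (lt_trans z0 zG)).
  by rewrite lte_fin lt_min zF.
Qed.

End line_integrals.

(** * Integrating out one coordinate *)

Section admissible_integral_line.
Context {R : realType}.
Local Notation mu := (@lebesgue_measure R).

Definition bounded_on_segment (f : R -> R) (M B : R) :=
  forall x, 0 <= f x <= M /\ (f x != 0 -> 0 <= x <= B).

Lemma integral_positive_half (f : R -> R) M B : measurable_fun [set: R] f ->
  bounded_on_segment f M B ->
  (\int[mu]_x (f x)%:E = \int[mu]_(x in `]0%R, +oo[) (f x)%:E)%E.
Proof.
move=> mf fMB; have mf' : measurable_fun [set: R] (EFin \o f) by exact/measurable_EFinP.
rewrite integral_itv_obnd_cbnd; last exact: measurable_funTS.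
rewrite [RHS]integral_mkcond; apply: eq_integral => x _.
rewrite patchE; case: ifPn => //; rewrite notin_setE/= in_itv/= andbT => /negP x0.
have [//|/eqP fx0] := eqVneq (f x) 0; first by move=> ->.
by case: (fMB x) => _ /(_ _)/andP[|/(negP x0)]//; exact/eqP.
Qed.

(** The integrand obtained from [f] by the substitution [x = u ^ a]. *)
Definition powR_pullback a (f : R -> R) (u : R) : R :=
  if 0 < u then a * u `^ (a - 1) * f (u `^ a) else 0.

Lemma integral_powR_pullback a (f : R -> R) M B : 1 <= a -> measurable_fun [set: R] f ->
  bounded_on_segment f M B ->
  (\int[mu]_u (powR_pullback a f u)%:E = \int[mu]_x (f x)%:E)%E.
Proof.
move=> a1 mf fMB; rewrite (integral_positive_half mf fMB) (ge0_integral_powR a1)//.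
- apply: eq_integral => u _; rewrite /powR_pullback /powR_density.
  by case: ifP; rewrite ?mul0e ?EFinM.
- exact/measurable_EFinP.
- by move=> x; rewrite lee_fin; case: (fMB x) => /andP[].
Qed.

Lemma measurable_powR_pullback a (f : R -> R) : measurable_fun [set: R] f ->
  measurable_fun [set: R] (powR_pullback a f).
Proof.
move=> mf; apply: measurable_fun_ifT => //; first exact: measurable_fun_ltr.
apply: measurable_funM.
  by apply: measurable_funM => //; exact: measurable_powR.
by apply: (measurableT_comp mf); exact: measurable_powR.
Qed.

(** Division by the supremum [s]; it is positive because the integral is.  The
last clause recovers [f] from the normalized function. *)
Lemma normalized_powR_pullback a (f : R -> R) M B X : 1 <= a ->
  measurable_fun [set: R] f -> bounded_on_segment f M B ->
  (\int[mu]_x (f x)%:E = X%:E)%E -> 0 < X ->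
  exists (s b : R) (F : R -> R),
    [/\ 0 < s, measurable_fun [set: R] F, (\int[mu]_u (F u)%:E = (X / s)%:E)%E &
    [/\ forall u, 0 <= F u <= 1, forall z, z < 1 -> exists u, z < F u,
       forall u, F u != 0 -> 0 <= u <= b &
       forall u, 0 < F u ->
         [/\ 0 < u, 0 < f (u `^ a) & f (u `^ a) = F u / a * (s * u `^ (- (a - 1)))]]].
Proof.
move=> a1 mf fMB fX X0.
have a0 : 0 < a by lra.
have f0 x : 0 <= f x by case: (fMB x) => /andP[].
have fM x : f x <= M by case: (fMB x) => /andP[].
have M0 : 0 <= M by exact: le_trans (f0 0) (fM 0).
pose F := powR_pullback a f; pose b := B `^ a^-1.
have F0 u : 0 <= F u.
  by rewrite /F /powR_pullback; case: ifP => // _; rewrite !mulr_ge0// ?powR_ge0// ltW.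
have Fsupp u : F u != 0 -> 0 < u <= b.
  rewrite /F /powR_pullback; case: ltP => [u0|]; last by rewrite eqxx.
  rewrite mulf_eq0 negb_or => /andP[_ fu] /=.
  have /andP[_ uB] := (fMB _).2 fu.
  rewrite leNgt; apply/negP => bu.
  move: uB; rewrite leNgt => /negP; apply.
  have B0 : 0 <= B by case/andP: ((fMB _).2 fu) => h1 h2; exact: le_trans h2.
  rewrite -[ltLHS](powRr1 B0) -(mulVf (lt0r_neq0 a0)) powRrM.
  by rewrite gt0_ltr_powR// nnegrE ?powR_ge0// ltW.
pose L := a * b `^ (a - 1) * M.
have FL u : F u <= L.
  have L0 : 0 <= L by rewrite !mulr_ge0// ?powR_ge0// ltW.
  have [->//|/Fsupp/andP[u0 ub]] := eqVneq (F u) 0.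
  rewrite /F /powR_pullback u0 ler_pM// ?mulr_ge0 ?powR_ge0 ?(ltW a0)//.
  rewrite ler_pM2l// ge0_ler_powR// ?nnegrE ?subr_ge0// ?powR_ge0//.
  exact: ltW.
have FX : (\int[mu]_u (F u)%:E = X%:E)%E by rewrite (integral_powR_pullback a1 mf fMB).
have [u0 Fu0] : exists u, 0 < F u.
  apply: contrapT => /forallNP F00; move: FX; rewrite integral0_eq.
    by move=> [/esym/eqP]; rewrite (gt_eqF X0).
  by move=> u _; congr EFin; apply/eqP; rewrite eq_le F0 andbT leNgt; apply/negP/F00.
have supF : has_sup (range F).
  by split; [exists (F u0); exists u0 | exists L => _ [u _ <-]].
pose s := sup (range F).
have Fs u : F u <= s by apply: ub_le_sup; [exact: supF.2 | exists u].
have s0 : 0 < s := lt_le_trans Fu0 (Fs u0).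
have mF : measurable_fun [set: R] F by exact: measurable_powR_pullback.
exists s, b, (fun u => F u / s); split => //.
- exact: measurable_funM.
- under eq_integral do rewrite mulrC EFinM.
  rewrite ge0_integralZl//; last 3 first.
  + exact/measurable_EFinP.
  + by move=> x _; rewrite lee_fin.
  + by rewrite lee_fin invr_ge0 ltW.
  by rewrite FX -EFinM mulrC.
split.
- by move=> u; apply/andP; split; [rewrite divr_ge0// ltW|rewrite ler_pdivrMr// mul1r].
- move=> z z1; have [_ [u _ <-] Hu] := sup_adherent (mulr_gt0 (ltac:(lra) : 0 < 1 - z) s0) supF.
  by exists u; rewrite ltr_pdivlMr//; apply: le_lt_trans Hu; rewrite -/s; lra.
- move=> u Fu; have /Fsupp/andP[/ltW -> ->]// : F u != 0.
  by apply: contraNneq Fu => ->; rewrite mul0r.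
move=> u; rewrite pmulr_lgt0 ?invr_gt0// => Fu.
have /Fsupp/andP[uu _] : F u != 0 by rewrite gt_eqF.
have pu : 0 < u `^ (a - 1) by rewrite powR_gt0.
have Fe : F u = a * u `^ (a - 1) * f (u `^ a) by rewrite /F /powR_pullback uu.
split => //.
  by move: Fu; rewrite Fe pmulr_rgt0// mulr_gt0.
by rewrite Fe powRN; field; rewrite !gt_eqF.
Qed.

Variables (C D : R) (N : R -> R -> R).
Hypotheses (C0 : 0 < C) (D0 : 0 < D).
Hypotheses (N0 : forall X Y, 0 < X -> 0 < Y -> 0 <= N X Y).
Hypothesis Nhom : superhomogeneous N.

(** With [w1], [w2] the integrals of the normalized functions, [admissible_split]
at [(w1, w2)] with exponent 1 replaces the integrals by the suprema [sF], [sG],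
and at [(u, v)] with exponent [a - 1] takes care of the Jacobian.
What is left is the hypothesis of [integral_brunn_minkowski] for a multiple of the pullback of [h]. *)
Lemma admissible_integral_line s al (f g : R -> R) (h : R -> \bar R) M B X Y :
  0 <= s -> 0 < al <= 1 ->
  measurable_fun [set: R] f -> measurable_fun [set: R] g -> measurable_fun [set: R] h ->
  bounded_on_segment f M B -> bounded_on_segment g M B -> (forall x, 0 <= h x)%E ->
  (forall x y, 0 < x -> 0 < y -> 0 < f x -> 0 < g y ->
    forall k, admissible C D N s (f x) (g y) k ->
    (k%:E <= h ((C * x `^ al + D * y `^ al) `^ al^-1)%R)%E) ->
  (\int[mu]_x (f x)%:E = X%:E)%E -> (\int[mu]_x (g x)%:E = Y%:E)%E -> 0 < X -> 0 < Y ->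
  forall k, admissible C D N (s + al^-1) X Y k -> (k%:E <= \int[mu]_x h x)%E.
Proof.
move=> s0 /andP[al0 al1] mf mg mh fMB gMB h0 fgh fX gY X0 Y0 k adm.
have [k0|k0] := leP k 0.
  by apply: (@le_trans _ _ 0%E); [rewrite lee_fin|exact: integral_ge0].
pose a := al^-1.
have a1 : 1 <= a by rewrite invr_ge1 ?unitfE ?gt_eqF// inE.
have a0 : 0 < a by lra.
have [sF [bF [F [sF0 mF FX [F01 Fsup Fsupp Fpos]]]]] := normalized_powR_pullback a1 mf fMB fX X0.
have [sG [bG [G [sG0 mG GY [G01 Gsup Gsupp Gpos]]]]] := normalized_powR_pullback a1 mg gMB gY Y0.
pose w1 := X / sF; pose w2 := Y / sG.
have w10 : 0 < w1 by rewrite divr_gt0.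
have w20 : 0 < w2 by rewrite divr_gt0.
pose W := C * w1 + D * w2.
have W0 : 0 < W by rewrite addr_gt0// mulr_gt0.
pose K (u : R) := ((W / k)%:E * (powR_density a u * h (u `^ a)%R))%E.
have mKh : measurable_fun [set: R] (fun u => powR_density a u * h (u `^ a)%R)%E.
  apply: emeasurable_funM; first exact: measurable_powR_density.
  by apply: (measurableT_comp mh); exact: measurable_powR.
have Kh0 u : (0 <= powR_density a u * h (u `^ a)%R)%E.
  by rewrite mule_ge0// powR_density_ge0// ltW.
have Wk0 : (0 <= (W / k)%:E)%E by rewrite lee_fin divr_ge0// ltW.
have mK : measurable_fun [set: R] K by exact: emeasurable_funM.
have hb : (W%:E <= (W / k)%:E * \int[mu]_x h x)%E.
  apply: (@le_trans _ _ (\int[mu]_u K u)%E); last first.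
    rewrite ge0_integralZl// lee_wpmul2l// -ge0_integral_powR//.
    by apply: ge0_subset_integral => //; exact: measurable_itv.
  have := @integral_brunn_minkowski R C D (Num.max bF bG) F G K C0 D0 mF mG mK F01 G01.
  rewrite FX GY -!EFinM -EFinD; apply => //.
  - by move=> u; rewrite /K mule_ge0.
  - by move=> u /Fsupp/andP[-> ub]; rewrite le_max ub.
  - by move=> u /Gsupp/andP[-> ub]; rewrite le_max ub orbT.
  move=> u v Fu Gv.
  have [u0 fu fE] := Fpos _ Fu; have [v0 gv gE] := Gpos _ Gv.
  set m := Num.min (F u) (G v).
  have m0 : 0 < m by rewrite /m lt_min Fu.
  have uv0 : 0 < C * u + D * v by rewrite addr_gt0// mulr_gt0.
  have sa : s + al^-1 = (s + (a - 1)) + 1 by rewrite /a; ring.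
  have a10 : 0 <= a - 1 by lra.
  have := adm; rewrite sa => adm1.
  have := admissible_split C0 D0 N0 (addr_ge0 s0 a10) ler01 X0 Y0 w10 w20 adm1.
  have -> : X * w1 `^ (-1) = sF by rewrite powR_inv1 ?(ltW w10)// /w1; field; rewrite !gt_eqF.
  have -> : Y * w2 `^ (-1) = sG by rewrite powR_inv1 ?(ltW w20)// /w2; field; rewrite !gt_eqF.
  rewrite -/W powRr1 ?(ltW W0)// => adm2.
  have adm3 := admissible_split C0 D0 N0 s0 a10 sF0 sG0 u0 v0 adm2.
  have ma0 : 0 < m / a by rewrite divr_gt0.
  (* [F u * sF] is at least [m * sF], and [f] is recovered by dividing by the Jacobian. *)
  have adm4 : admissible C D N s (f (u `^ a)) (g (v `^ a))
      (m / a * (k / W / (C * u + D * v) `^ (a - 1))).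
    apply: (admissible_scale Nhom ma0 _ _ _ _ adm3); rewrite ?mulr_gt0 ?powR_gt0//.
    - by rewrite fE ler_pM2r ?mulr_gt0 ?powR_gt0// ler_pM2r ?invr_gt0// /m ge_min lexx.
    - by rewrite gE ler_pM2r ?mulr_gt0 ?powR_gt0// ler_pM2r ?invr_gt0// /m ge_min lexx orbT.
  have /fgh : 0 < u `^ a by rewrite powR_gt0.
  move=> /(_ (v `^ a)); rewrite powR_gt0// => /(_ isT fu gv _ adm4).
  have aK x : 0 < x -> (x `^ a) `^ al = x.
    by move=> x0; rewrite -powRrM mulVf ?gt_eqF// powRr1// ltW.
  rewrite !aK// -/a => hle.
  apply: le_trans (lee_wpmul2l Wk0 (lee_wpmul2l (powR_density_ge0 _ (ltW a0)) hle)).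
  rewrite /powR_density uv0 -!EFinM lee_fin.
  have pw0 : 0 < (C * u + D * v) `^ (a - 1) by rewrite powR_gt0.
  rewrite le_eqVlt (_ : m == _)//; apply/eqP; field.
  by rewrite !gt_eqF.
move: hb; have -> : W%:E = ((W / k)%:E * k%:E)%E.
  by rewrite -EFinM divfK// gt_eqF.
by rewrite lee_pmul2l// lte_fin divr_gt0.
Qed.

End admissible_integral_line.

(** * Integrating out all coordinates *)

Section borel_lebesgue_cons.
Context {R : realType}.
Local Notation mu := (@lebesgue_measure R).
Local Notation vec n := (n.-tuple (measurableTypeR R)).

Lemma measurable_tuple_consr n (x : R) :
  measurable_fun [set: vec n] (fun z : vec n => tuple_cons ((x : measurableTypeR R), z)).
Proof.
apply: (@measurableT_comp _ _ _ _ _ _ (@tuple_cons R n)); first exact: measurable_tuple_cons.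
exact: measurable_pair1.
Qed.

Lemma ge0_integral_cons n (F : vec n.+1 -> \bar R) : measurable_fun [set: vec n.+1] F ->
  (forall x, 0 <= F x)%E ->
  (\int[borel_lebesgue R n.+1]_x F x =
   \int[mu]_x \int[borel_lebesgue R n]_z F (tuple_cons ((x : measurableTypeR R), z)))%E.
Proof.
move=> mF F0.
have mc := @measurable_tuple_cons R n.
transitivity (\int[(mu \x borel_lebesgue R n)%E]_xz (F \o @tuple_cons R n) xz)%E.
  have := @ge0_integral_pushforward _ _ _ _ R _ mc
    (mu \x borel_lebesgue R n)%E setT F measurableT mF.
  by rewrite preimage_setT; apply => y _.
by rewrite fubini_tonelli1//; [apply: measurableT_comp; [exact: mF|exact: mc]|move=> ?; exact: F0].
Qed.

Lemma measurable_integral_cons n (F : vec n.+1 -> \bar R) : measurable_fun [set: vec n.+1] F ->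
  (forall x, 0 <= F x)%E ->
  measurable_fun [set: R] (fun x : R =>
    \int[borel_lebesgue R n]_z F (tuple_cons ((x : measurableTypeR R), z)))%E.
Proof.
move=> mF F0.
have mc := @measurable_tuple_cons R n.
apply: (@measurable_fun_fubini_tonelli_F _ _ _ _ _ _ (F \o @tuple_cons R n)).
  by apply: measurableT_comp; [exact: mF|exact: mc].
by move=> ?; exact: F0.
Qed.

Definition cube n (B : R) : set (vec n) := [set z | forall i, 0 <= tnth z i <= B].

Lemma measurable_cube n B : measurable (@cube n B).
Proof.
rewrite (_ : cube B = \bigcap_(i in [set: 'I_n])
    ((fun z : vec n => tnth z i) @^-1` `[0, B]%classic)); last first.
  by apply/seteqP; split=> z zB i; [move=> _|]; have := zB i;
    rewrite /= in_itv//; apply.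
apply: fin_bigcap_measurable; first exact: finite_finset.
move=> i _; rewrite -[X in measurable X]setTI; by apply: measurable_tnth => //.
Qed.

Lemma cube_cons n B x (z : vec n) :
  cube B (tuple_cons ((x : measurableTypeR R), z)) <-> 0 <= x <= B /\ cube B z.
Proof.
split=> [h|[h1 h2] i].
  split; first by have := h ord0; rewrite tnth0.
  by move=> i; have := h (lift ord0 i); rewrite tnthS.
by case: (unliftP ord0 i) => [j ->|->]; rewrite ?tnthS ?tnth0//; exact: h2.
Qed.

Lemma borel_lebesgue_cube n B : (borel_lebesgue R n (@cube n B) < +oo)%E.
Proof.
elim: n => [|n IH].
  by rewrite /= diracE; case: (_ \in _); rewrite ltry.
rewrite /= /cons_product /pushforward.
rewrite (_ : _ @^-1` _ = `[0, B]%classic `*` @cube n B); last first.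
  apply/seteqP; split=> -[x z] /=.
    by move/cube_cons => [h1 h2]; split => //=; rewrite in_itv.
  by move=> [/= h1 h2]; apply/cube_cons; rewrite in_itv/= in h1.
rewrite product_measure1E//; last exact: measurable_cube.
have I_fin : (mu `[0%R, B]%classic < +oo)%E.
  by rewrite lebesgue_measure_itv/=; case: ifP => // _; rewrite -EFinB ltry.
by rewrite lte_mul_pinfty// ge0_fin_numE.
Qed.

End borel_lebesgue_cons.

Section admissible_integral_tuple.
Context {R : realType}.
Local Notation vec n := (n.-tuple (measurableTypeR R)).
Variables (C D : R) (N : R -> R -> R).
Hypotheses (C0 : 0 < C) (D0 : 0 < D).
Hypotheses (N0 : forall X Y, 0 < X -> 0 < Y -> 0 <= N X Y).
Hypothesis Nhom : superhomogeneous N.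

Definition bounded_on_cube n (f : vec n -> R) (M B : R) :=
  forall x, 0 <= f x <= M /\ (f x != 0 -> cube B x).

Definition coord_mean n (al : 'I_n -> R) (x y : vec n) : vec n :=
  [tuple (C * tnth x i `^ al i + D * tnth y i `^ al i) `^ (al i)^-1 | i < n].

Lemma coord_mean_cons n (al : 'I_n.+1 -> R) (x y : R) (z w : vec n) :
  coord_mean al (tuple_cons (x : measurableTypeR R, z)) (tuple_cons (y : measurableTypeR R, w)) =
  tuple_cons ((C * x `^ al ord0 + D * y `^ al ord0) `^ (al ord0)^-1 : measurableTypeR R,
              coord_mean (al \o lift ord0) z w).
Proof.
apply: eq_from_tnth => i; rewrite tnth_mktuple.
by case: (unliftP ord0 i) => [j ->|->]; rewrite ?tnthS ?tnth0// tnth_mktuple.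
Qed.

(** Integrals over slices are again real-valued, measurable, bounded and supported
in a segment, which is what the induction on the dimension requires. *)
Lemma slice_integral n (f : vec n.+1 -> R) M B : measurable_fun [set: vec n.+1] f ->
  bounded_on_cube f M B ->
  exists F : R -> R, exists M', [/\ measurable_fun [set: R] F, bounded_on_segment F M' B &
    forall x, (\int[borel_lebesgue R n]_z (f (tuple_cons (x : measurableTypeR R, z)))%:E =
      (F x)%:E)%E].
Proof.
move=> mf fMB.
have f0 x : (0 <= (f x)%:E)%E by rewrite lee_fin; case: (fMB x) => /andP[].
have M0 : 0 <= M by case: (fMB [tuple of nseq n.+1 0]) => /andP[h1 h2] _; exact: le_trans h2.
pose V := borel_lebesgue R n (@cube R n B).
have V0 : (0 <= V)%E by exact: measure_ge0.
have Vfin : V \is a fin_num by rewrite ge0_fin_numE; [exact: borel_lebesgue_cube|exact: V0].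
pose I x := (\int[borel_lebesgue R n]_z (f (tuple_cons (x : measurableTypeR R, z)))%:E)%E.
have I0 x : (0 <= I x)%E by exact: integral_ge0.
have mfx x : measurable_fun [set: vec n] (fun z => (f (tuple_cons (x : measurableTypeR R, z)))%:E).
  apply/measurable_EFinP; apply: (measurableT_comp mf).
  exact: measurable_tuple_consr.
have IV x : (I x <= M%:E * V)%E.
  rewrite /V -(setIT (cube B)) -integral_indic//; last exact: measurable_cube.
  rewrite -ge0_integralZl//; last first.
    by apply/measurable_EFinP; apply: measurable_indic; exact: measurable_cube.
  apply: ge0_le_integral => //.
  - apply: emeasurable_funM => //.
    by apply/measurable_EFinP; apply: measurable_indic; exact: measurable_cube.
  move=> z _; rewrite -EFinM lee_fin indicE.
  have [zB|zB] := boolP (z \in cube B); last first.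
    rewrite mulr0; have [->//|] := eqVneq (f (tuple_cons (x : measurableTypeR R, z))) 0.
    by move/(fMB _).2/cube_cons => -[_ zB']; move: zB; rewrite notin_setE.
  by rewrite mulr1; case: (fMB (tuple_cons (x : measurableTypeR R, z))) => /andP[].
have MVfin : (M%:E * V)%E \is a fin_num by rewrite fin_numM.
have Ifin x : I x \is a fin_num.
  by rewrite ge0_fin_numE// (le_lt_trans (IV x))// -ge0_fin_numE// mule_ge0.
exists (fun x => fine (I x)), (fine (M%:E * V)%E); split.
- apply: (@measurableT_comp _ _ _ _ _ _ fine); first by [].
  rewrite /I.
  apply: (@measurable_integral_cons R n (EFin \o f)) => //.
  exact/measurable_EFinP.
- move=> x; split; first by rewrite fine_ge0//= fine_le.
  have [xB //|xB] := boolP (0 <= x <= B).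
  rewrite (_ : I x = 0%E) ?eqxx//; apply: integral0_eq => z _; congr EFin.
  apply/eqP; apply: contraNT xB => /(fMB _).2/cube_cons[//].
- by move=> x; rewrite fineK.
Qed.

(** Induction on [n]: the slices satisfy the hypothesis for each fixed pair of first
coordinates, so the slice integrals satisfy the hypothesis of the line at a later
stage.  Only points with positive coordinates are tested: 0 is negligible on the line,
and at each step this discards one hyperplane. *)
Lemma admissible_integral_tuple n (al : 'I_n -> R) s (f g : vec n -> R) (h : vec n -> \bar R)
    M B X Y :
  0 <= s -> (forall i, 0 < al i <= 1) ->
  measurable_fun [set: vec n] f -> measurable_fun [set: vec n] g -> measurable_fun [set: vec n] h ->
  bounded_on_cube f M B -> bounded_on_cube g M B -> (forall x, 0 <= h x)%E ->
  (forall x y, (forall i, 0 < tnth x i) -> (forall i, 0 < tnth y i) -> 0 < f x -> 0 < g y ->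
    forall k, admissible C D N s (f x) (g y) k -> (k%:E <= h (coord_mean al x y))%E) ->
  (\int[borel_lebesgue R n]_x (f x)%:E = X%:E)%E ->
  (\int[borel_lebesgue R n]_x (g x)%:E = Y%:E)%E -> 0 < X -> 0 < Y ->
  forall k, admissible C D N (s + \sum_(i < n) (al i)^-1) X Y k ->
  (k%:E <= \int[borel_lebesgue R n]_x h x)%E.
Proof.
elim: n al s f g h M B X Y => [|n IH] al s f g h M B X Y s0 al01 mf mg mh fMB gMB h0 fgh.
  rewrite /= !integral_dirac//; [|exact/measurable_EFinP|exact/measurable_EFinP].
  rewrite !diracT !mul1e => -[fX] [gY] X0 Y0 k; rewrite big_ord0 addr0 -fX -gY => adm.
  have := fgh [tuple] [tuple] _ _ _ _ k adm; rewrite (tuple0 (coord_mean _ _ _)).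
  by apply; [case|case|rewrite fX|rewrite gY].
have f0 x : (0 <= (f x)%:E)%E by rewrite lee_fin; case: (fMB x) => /andP[].
have g0 x : (0 <= (g x)%:E)%E by rewrite lee_fin; case: (gMB x) => /andP[].
rewrite !ge0_integral_cons//; [|exact/measurable_EFinP|exact/measurable_EFinP].
have [F [MF [mF FMB FE]]] := slice_integral mf fMB.
have [G [MG [mG GMB GE]]] := slice_integral mg gMB.
under eq_integral do rewrite FE.
under [X in X = Y%:E -> _]eq_integral do rewrite GE.
move=> FX GY X0 Y0 k.
have alS i : 0 < (al \o lift ord0) i <= 1 by exact: al01.
rewrite big_ord_recl [_^-1 + _]addrC addrA => adm.
pose MM := Num.max MF MG.
have s'0 : 0 <= s + \sum_(i < n) (al (lift ord0 i))^-1.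
  by rewrite addr_ge0// sumr_ge0// => i _; rewrite invr_ge0 ltW//; case/andP: (alS i).
apply: (admissible_integral_line C0 D0 N0 Nhom s'0 (al01 ord0) mF mG _
  (M := MM) (B := B) _ _ _ _ FX GY X0 Y0 adm).
- exact: measurable_integral_cons.
- by move=> x; case: (FMB x) => /andP[-> h1] h2; split => //; rewrite le_max h1.
- by move=> x; case: (GMB x) => /andP[-> h1] h2; split => //; rewrite le_max h1 orbT.
- by move=> x; exact: integral_ge0.
move=> x y x0 y0 Fx Gy k' adm'.
apply: (IH (al \o lift ord0) s (fun z => f (tuple_cons (x : measurableTypeR R, z)))
  (fun z => g (tuple_cons (y : measurableTypeR R, z)))
  (fun z => h (tuple_cons (_ : measurableTypeR R, z))) M B _ _ s0 alS
  _ _ _ _ _ _ _ (FE x) (GE y) Fx Gy k' adm').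
- by apply: (measurableT_comp mf); exact: measurable_tuple_consr.
- by apply: (measurableT_comp mg); exact: measurable_tuple_consr.
- by apply: (measurableT_comp mh); exact: measurable_tuple_consr.
- move=> z; have [h1 h2] := fMB (tuple_cons (x : measurableTypeR R, z)).
  by split => // /h2/cube_cons[].
- move=> z; have [h1 h2] := gMB (tuple_cons (y : measurableTypeR R, z)).
  by split => // /h2/cube_cons[].
- by [].
move=> z w z0 w0 fz gw k'' adm''; rewrite -coord_mean_cons; apply: fgh => //.
- by move=> i; case: (unliftP ord0 i) => [j ->|->]; rewrite ?tnthS ?tnth0.
- by move=> i; case: (unliftP ord0 i) => [j ->|->]; rewrite ?tnthS ?tnth0.
Qed.

End admissible_integral_tuple.

(** * From Lebesgue measurable to Borel functions *)

Section completion.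
Context d (T : measurableType d) (R : realType).
Variable m : {sigma_finite_measure set T -> \bar R}.
Local Notation cm := (@completed_measure_extension _ _ _ m).
Local Notation cmeasurable := ((m^*)%mu.-cara.-measurable).
Local Open Scope ereal_scope.

Lemma completed_measureE (A : set T) : d.-measurable A -> cm A = m A.
Proof. by move=> mA; exact: measurable_mu_extE. Qed.

Lemma measurable_completed (A : set T) : d.-measurable A -> cmeasurable A.
Proof. by move=> mA; exact: caratheodory_measurable_mu_ext. Qed.

(** Intersect countable covers that are optimal up to [1 / n]. *)
Lemma outer_measurable_hull (X : set T) : (m^*)%mu X < +oo ->
  exists G, [/\ measurable G, X `<=` G & m G = (m^*)%mu X].
Proof.
move=> Xoo.
have Xfin : (m^*)%mu X \is a fin_num by rewrite ge0_fin_numE//; exact: mu_ext_ge0.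
have cover n : exists G, [/\ measurable G, X `<=` G & m G <= (m^*)%mu X + n.+1%:R^-1%:E].
  have n0 : (0 < n.+1%:R^-1 :> R)%R by rewrite invr_gt0.
  have [_ [A [mA XA] <-] mAX] := lb_ereal_inf_adherent n0 Xfin.
  exists (\bigcup_k A k); split => //; first exact: bigcupT_measurable.
  apply: le_trans (ltW mAX).
  by apply: measure_sigma_subadditive => //; exact: bigcupT_measurable.
have [G GP] := choice cover.
exists (\bigcap_n G n); split.
- by apply: bigcapT_measurable => n; have [] := GP n.
- by move=> x Xx n _; have [_ + _] := GP n; apply.
have mG : measurable (\bigcap_n G n) by apply: bigcapT_measurable => n; have [] := GP n.
apply/eqP; rewrite eq_le; apply/andP; split; last first.
  rewrite -(measurable_mu_extE m mG); apply: le_mu_ext => x Xx n _.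
  by have [_ + _] := GP n; apply.
apply/lee_addgt0Pr => /= _/posnumP[e]; near \oo => n.
have [mGn _ Gn] := GP n.
apply: (@le_trans _ _ (m (G n))).
  by apply: le_measure; rewrite ?inE// => x; apply.
apply: (le_trans Gn); rewrite leeD// lee_fin ltW//.
by near: n; apply: near_infty_natSinv_lt.
Unshelve. all: by end_near. Qed.

Lemma bigcup_measure0 (N : (set T)^nat) : (forall n, d.-measurable (N n)) ->
  (forall n, m (N n) = 0) -> m (\bigcup_n N n) = 0.
Proof.
move=> mN N0; apply/eqP; rewrite -measure_le0.
apply: (@le_trans _ _ (\sum_(n <oo) m (N n))).
  by apply: measure_sigma_subadditive => //; exact: bigcupT_measurable.
by rewrite eseries0.
Qed.

(** On each piece of finite measure, [E] differs from a measurable hull by a set of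
outer measure 0, which is contained in a null hull of its own. *)
Lemma completed_measurable_borel (E : set T) : cmeasurable E ->
  exists N, [/\ d.-measurable N, m N = 0 & d.-measurable (E `\` N)].
Proof.
move=> mE.
have [F FT mF] := sigma_finiteT m.
have mEF n : cmeasurable (E `&` F n).
  by apply: measurableI => //; apply: measurable_completed; exact: (mF n).1.
have nullset n : exists N, [/\ d.-measurable N, m N = 0 & d.-measurable ((E `&` F n) `\` N)].
  have Foo : (m^*)%mu (E `&` F n) < +oo.
    apply: (@le_lt_trans _ _ ((m^*)%mu (F n))); first by apply: le_mu_ext; exact: subIsetr.
    by rewrite measurable_mu_extE; [exact: (mF n).2|exact: (mF n).1].
  have [G [mG EG mGE]] := outer_measurable_hull Foo.
  (* The outer measure is additive on the completed sigma-algebra. *)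
  have G0 : (m^*)%mu (G `\` (E `&` F n)) = 0.
    have cG : cm G = (m^*)%mu (E `&` F n) by rewrite -mGE completed_measureE.
    have GD : cm (G `\` (E `&` F n)) = cm G - cm (G `&` (E `&` F n)).
      by apply: measureD; [exact: measurable_completed|exact: mEF|rewrite /= cG].
    transitivity (cm (G `\` (E `&` F n))); first by [].
    rewrite GD (setIidr EG) cG; apply: subee.
    by rewrite ge0_fin_numE//; exact: mu_ext_ge0.
  have [N [mN GN mN0]] : exists N, [/\ measurable N, G `\` (E `&` F n) `<=` N & m N = 0].
    by rewrite -G0; apply: outer_measurable_hull; rewrite G0.
  exists N; split => //.
  rewrite (_ : _ `\` N = G `\` N); first by apply: measurableD; [exact: mG|exact: mN].
  apply/seteqP; split=> x [xA xN]; split => //; first exact: EG.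
  by apply: contrapT => xE; apply: xN; exact: GN.
have [N NP] := choice nullset.
have mN : measurable (\bigcup_n N n) by apply: bigcupT_measurable => n; have [] := NP n.
exists (\bigcup_n N n); split => //.
  by apply: bigcup_measure0 => n; have [] := NP n.
rewrite (_ : _ `\` _ = \bigcup_n ((E `&` F n `\` N n) `\` \bigcup_n N n)).
  by apply: bigcupT_measurable => n; apply: measurableD => //; have [] := NP n.
apply/seteqP; split=> x.
  move=> [Ex Nx]; have [n _ Fx] : (\bigcup_n F n) x by rewrite -FT.
  by exists n => //; split => //; split => // Nnx; apply: Nx; exists n.
by move=> [n _ [[[Ex _] _] Nx]].
Qed.

(** Remove the exceptional sets of the superlevel sets at all rational levels. *)
Lemma completed_measurable_fun_borel (D : set T) (f : T -> R) :
  @measurable_fun _ _ (caratheodory_type (m^*)%mu) _ D f ->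
  d.-measurable D ->
  exists N, [/\ d.-measurable N, m N = 0 & measurable_fun (D `\` N) f].
Proof.
move=> mf mD.
(* Codes of no rational are sent to 0; only surjectivity onto the rationals matters. *)
pose q n : R := ratr (odflt 0%R (unpickle n : option rat)).
have nullset n : exists N, [/\ d.-measurable N, m N = 0 &
    d.-measurable ((D `&` [set x | q n < f x]%R) `\` N)].
  apply: completed_measurable_borel.
  have := mf (measurable_completed mD) `]q n, +oo[%classic (measurable_itv _).
  congr (cmeasurable (D `&` _)); apply/seteqP; by split=> x /=; rewrite in_itv/= andbT.
have [N NP] := choice nullset.
have mN : measurable (\bigcup_n N n) by apply: bigcupT_measurable => n; have [] := NP n.
exists (\bigcup_n N n); split => //.
  by apply: bigcup_measure0 => n; have [] := NP n.
apply: (measurability _ (RGenOInfty.measurableE R)) => //= _ [_ [r ->] <-].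
rewrite (_ : _ `&` _ = \bigcup_(n in [set n | r < q n]%R)
    (((D `&` [set x | q n < f x]%R) `\` N n) `\` \bigcup_n N n)).
  by apply: bigcup_measurable => n _; apply: measurableD => //; have [] := NP n.
apply/seteqP; split=> x.
  move=> [[Dx Nx]] /=; rewrite in_itv/= andbT => rf.
  have [p] := rat_in_itvoo rf; rewrite in_itv/= => /andP[rp pf].
  have qp : q (pickle p) = ratr p by rewrite /q pickleK.
  exists (pickle p); rewrite /= ?qp//.
  by split => //; split => // Npx; apply: Nx; exists (pickle p).
move=> [n /= rq [[[Dx qf] _] Nx]]; split => //=.
by rewrite in_itv/= andbT (lt_trans rq).
Qed.

Lemma ge0_integral_completed (f : T -> \bar R) : measurable_fun [set: T] f ->
  (forall x, 0 <= f x) -> \int[cm]_x f x = \int[m]_x f x.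
Proof.
move=> mf f0.
have mid : @measurable_fun _ _ (caratheodory_type (m^*)%mu) T setT id.
  by move=> _ A mA; rewrite setTI; exact: measurable_completed.
have := @ge0_integral_pushforward _ _ _ _ R _ mid cm setT f measurableT mf.
rewrite preimage_setT => <-//.
apply: eq_measure_integral => A mA _; exact: completed_measureE.
Qed.

End completion.

(** * Integrals over the orthant *)

Section orthant_integral.
Context {R : realType}.
Local Notation vec n := (n.-tuple (measurableTypeR R)).
Local Notation bl n := (borel_lebesgue R n).

Lemma measurable_orthant n : measurable (orthant R n : set (vec n)).
Proof.
rewrite (_ : orthant R n = \bigcap_(i in [set: 'I_n])
    ((fun z : vec n => tnth z i) @^-1` `[0, +oo[%classic)); last first.
  apply/seteqP; split=> z zB i; [move=> _|]; have := zB i; rewrite /= in_itv/= andbT//.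
  by apply.
apply: fin_bigcap_measurable; first exact: finite_finset.
move=> i _; rewrite -[X in measurable X]setTI.
by apply: measurable_tnth.
Qed.

Lemma lebesgue_orthant_integral n (N : set (vec n)) (f : n.-tuple R -> R)
    (f' : vec n -> \bar R) :
  (lebesgue R n).-integrable (orthant R n) (EFin \o f) ->
  (forall x, orthant R n x -> 0 <= f x) ->
  measurable N -> bl n N = 0%E ->
  measurable_fun [set: vec n] f' -> (forall x, 0 <= f' x)%E ->
  (forall x, ~ N x -> f' x = ((EFin \o f) \_ (orthant R n)) x) ->
  (\int[bl n]_x f' x = (\int[lebesgue R n]_(x in orthant R n) f x)%:E)%E.
Proof.
move=> fint f0 mN N0 mf' f'0 f'E.
have mor := measurable_completed (bl n) (@measurable_orthant n).
rewrite /Rintegral fineK; last by apply: integrable_fin_num.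
rewrite -ge0_integral_completed// [RHS]integral_mkcond.
apply: ge0_ae_eq_integral.
- exact: measurableT.
- move=> _ A mA; rewrite setTI; apply: measurable_completed.
  by rewrite -[X in measurable X]setTI; exact: mf'.
- apply: (measurable_restrictT _ mor).1; exact: measurable_int fint.
- by move=> x _; exact: f'0.
- by move=> x _; rewrite patchE; case: ifPn => // /set_mem xo; rewrite lee_fin f0.
exists N; split.
- exact: measurable_completed.
- by rewrite -N0; exact: completed_measureE.
- by move=> x /= h; apply: contrapT => Nx; apply: h => _; rewrite f'E.
Qed.

End orthant_integral.

Section lebesgue_version.
Context {R : realType}.
Local Notation vec n := (n.-tuple (measurableTypeR R)).
Local Notation bl n := (borel_lebesgue R n).
Variables (C D : R) (N : R -> R -> R).
Hypotheses (C0 : 0 < C) (D0 : 0 < D).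
Hypotheses (N0 : forall X Y, 0 < X -> 0 < Y -> 0 <= N X Y).
Hypothesis Nhom : superhomogeneous N.

Lemma bounded_on_cube_patch n (f : n.-tuple R -> R) (A : set (vec n)) :
  (forall x, orthant R n x -> 0 <= f x) ->
  [bounded f x | x in orthant R n] -> has_bounded_support f ->
  A `<=` orthant R n ->
  exists M B, forall M' B', M <= M' -> B <= B' -> bounded_on_cube (f \_ A) M' B'.
Proof.
move=> f0 [M1 [_ fM1]] [B fB] Ao; pose M := M1 + 1.
have fM x : orthant R n x -> `|f x| <= M.
  by move=> xo; apply: (fM1 M); rewrite /M ?ltrDl.
exists (Num.max M 0), B => M' B'; rewrite ge_max => /andP[MM' M'0] BB' x.
have [xA|xA] := boolP (x \in A); last first.
  by rewrite patchE (negbTE xA) lexx M'0 eqxx; split.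
have xo : orthant R n x by apply: Ao; exact: set_mem.
rewrite patchE xA; split; first by rewrite f0//= (le_trans (ler_norm _))// (le_trans (fM _ xo)).
by move=> fx i; rewrite (xo i)/= (le_trans (fB _ xo fx i)).
Qed.

Lemma measurable_patch n (f : n.-tuple R -> R) (A : set (vec n)) (B : set (vec n)) :
  measurable A -> measurable_fun (B : set (vec n)) (f : vec n -> R) -> A `<=` B -> measurable B ->
  measurable_fun [set: vec n] (f \_ A : vec n -> R).
Proof.
move=> mA mf AB mB; apply/(measurable_restrictT _ _).1 => //.
exact: measurable_funS mf.
Qed.

(** On the union [E] of the exceptional null sets, [f] and [g] are lowered to 0 and
[h] is raised to [+oo]; this preserves the pointwise hypothesis, which is required
at every pair of points and not almost everywhere. *)
Lemma admissible_integral_lebesgue n (al : 'I_n -> R) (f g h : n.-tuple R -> R) :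
  (forall i, 0 < al i <= 1) ->
  (forall x, orthant R n x -> 0 <= f x) -> (forall x, orthant R n x -> 0 <= g x) ->
  (forall x, orthant R n x -> 0 <= h x) ->
  [bounded f x | x in orthant R n] -> [bounded g x | x in orthant R n] ->
  (lebesgue R n).-integrable (orthant R n) (EFin \o f) ->
  (lebesgue R n).-integrable (orthant R n) (EFin \o g) ->
  (lebesgue R n).-integrable (orthant R n) (EFin \o h) ->
  has_bounded_support f -> has_bounded_support g ->
  (forall x y : n.-tuple R, (forall i, 0 < tnth x i) -> (forall i, 0 < tnth y i) ->
    0 < f x -> 0 < g y -> N (f x) (g y) <= h (coord_mean C D al x y)) ->
  let If := \int[lebesgue R n]_(x in orthant R n) f x in
  let Ig := \int[lebesgue R n]_(x in orthant R n) g x in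
  let Ih := \int[lebesgue R n]_(x in orthant R n) h x in
  0 < If -> 0 < Ig ->
  forall k, admissible C D N (\sum_(i < n) (al i)^-1) If Ig k -> k <= Ih.
Proof.
move=> al01 f0 g0 h0 fb gb fint gint hint fs gs fgh If Ig Ih If0 Ig0 k adm.
have mor := @measurable_orthant R n.
have borel (u : n.-tuple R -> R) : (lebesgue R n).-integrable (orthant R n) (EFin \o u) ->
    exists N, [/\ measurable N, bl n N = 0%E &
      measurable_fun ((orthant R n : set (vec n)) `\` N) (u : vec n -> R)].
  move=> uint; apply: completed_measurable_fun_borel => //.
  by apply/measurable_EFinP; exact: measurable_int uint.
have [Nf [mNf Nf0 mf]] := borel _ fint.
have [Ng [mNg Ng0 mg]] := borel _ gint.
have [Nh [mNh Nh0 mh]] := borel _ hint.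
pose E := Nf `|` Ng `|` Nh.
have mE : measurable E by apply: measurableU => //; exact: measurableU.
have E0 : bl n E = 0%E.
  have mfg : measurable (Nf `|` Ng) by exact: measurableU.
  exact: (etrans (measureU0 mfg mNh Nh0) (etrans (measureU0 mNf mNg Ng0) Nf0)).
pose A : set (vec n) := orthant R n `\` E.
have mA : measurable A by exact: measurableD.
have Ao : A `<=` orthant R n by move=> x [].
pose f' : vec n -> R := f \_ A.
pose g' : vec n -> R := g \_ A.
pose h' (x : vec n) : \bar R := if x \in E then +oo%E else ((h \_ A) x)%:E.
have mf' : measurable_fun [set: vec n] f'.
  apply: (measurable_patch mA mf); last exact: measurableD.
  by move=> x [xo xE]; split => // xN; apply: xE; left; left.
have mg' : measurable_fun [set: vec n] g'.
  apply: (measurable_patch mA mg); last exact: measurableD.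
  by move=> x [xo xE]; split => // xN; apply: xE; left; right.
have mh' : measurable_fun [set: vec n] h'.
  apply: measurable_fun_ifT => //.
    apply: (measurable_fun_bool true); rewrite setTI.
    by rewrite [X in measurable X](_ : _ = E)//; apply/seteqP; split=> x;
      [exact: set_mem|exact: mem_set].
  apply/measurable_EFinP; apply: (measurable_patch mA mh); last exact: measurableD.
  by move=> x [xo xE]; split => // xN; apply: xE; right.
have [Mf [Bf fMB]] := bounded_on_cube_patch f0 fb fs Ao.
have [Mg [Bg gMB]] := bounded_on_cube_patch g0 gb gs Ao.
have patchE_off (u : n.-tuple R -> R) (x : vec n) : ~ E x -> (u \_ A) x = (u \_ (orthant R n)) x.
  move=> Ex; rewrite !patchE; congr (if _ then _ else _).
  by apply/idP/idP => /set_mem; rewrite inE /A; [case|split].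
have patch_EFin (u : n.-tuple R -> R) x :
    (((u \_ (orthant R n)) x)%:E = ((EFin \o u) \_ (orthant R n)) x)%E.
  by rewrite !patchE; case: ifP.
have patch0 (u : n.-tuple R -> R) (u0 : forall x, orthant R n x -> 0 <= u x) x : 0 <= (u \_ A) x.
  by rewrite patchE; case: ifPn => // /set_mem/Ao/u0.
have fE : (\int[bl n]_x (f' x)%:E = If%:E)%E.
  apply: (lebesgue_orthant_integral fint f0 mE E0).
  - exact/measurable_EFinP.
  - by move=> x; rewrite lee_fin patch0.
  - by move=> x Ex; rewrite /f' patchE_off.
have gE : (\int[bl n]_x (g' x)%:E = Ig%:E)%E.
  apply: (lebesgue_orthant_integral gint g0 mE E0).
  - exact/measurable_EFinP.
  - by move=> x; rewrite lee_fin patch0.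
  - by move=> x Ex; rewrite /g' patchE_off.
have h'0 x : (0 <= h' x)%E by rewrite /h'; case: ifP => // _; rewrite lee_fin patch0.
have hE : (\int[bl n]_x h' x = Ih%:E)%E.
  apply: (lebesgue_orthant_integral hint h0 mE E0) => //.
  by move=> x Ex; rewrite /h' memNset// patchE_off.
rewrite -lee_fin -hE.
apply: (admissible_integral_tuple (M := Num.max Mf Mg) (B := Num.max Bf Bg)
  C0 D0 N0 Nhom (lexx 0) al01 mf' mg' mh' _ _ h'0 _ fE gE If0 Ig0).
- by apply: fMB; rewrite le_max lexx.
- by apply: gMB; rewrite le_max lexx orbT.
- move=> x y x0 y0 fx gy c admc.
  have patch_pos (u : n.-tuple R -> R) z : 0 < (u \_ A) z -> 0 < u z.
    by rewrite patchE; case: ifPn => // _; rewrite ltxx.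
  have fx' := patch_pos _ _ fx; have gy' := patch_pos _ _ gy.
  have fxE : f' x = f x by move: fx; rewrite /f' patchE; case: ifPn => // _; rewrite ltxx.
  have gyE : g' y = g y by move: gy; rewrite /g' patchE; case: ifPn => // _; rewrite ltxx.
  rewrite /h'; case: ifPn => [_|zE]; first exact: leey.
  rewrite patchE mem_set; last first.
    split; last by move: zE; rewrite notin_setE.
    by move=> i; rewrite tnth_mktuple powR_ge0.
  rewrite lee_fin (le_trans _ (fgh _ _ x0 y0 fx' gy'))//.
  have := admc 1 1 ltr01 ltr01.
  by rewrite oppr0 !powRr0 !mulr1 fxE gyE.
- by rewrite add0r.
Qed.

End lebesgue_version.

(** * Admissible values of power means *)

Section power_mean_admissible.
Context {R : realType}.
Implicit Types (C D X Y S r u v : R) (beta : \bar R).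

Lemma lt0_ler_powR r (x y : R) : r <= 0 -> 0 < x -> x <= y -> y `^ r <= x `^ r.
Proof.
move=> r0 x0 xy; rewrite -(opprK r) powRN [leRHS]powRN.
have y0 : 0 < y := lt_le_trans x0 xy.
rewrite lef_pV2 ?posrE ?powR_gt0//.
by apply: ge0_ler_powR; rewrite ?nnegrE ?oppr_ge0// ltW.
Qed.

Lemma power_mean_real C D r X Y : r != 0 -> 0 < X -> 0 < Y ->
  power_mean C D r%:E X Y = (C * X `^ r + D * Y `^ r) `^ r^-1.
Proof. by move=> r0 X0 Y0; rewrite /power_mean mulr_gt0// (negbTE r0). Qed.

Lemma power_mean_geom C D X Y : 0 < X -> 0 < Y ->
  power_mean C D 0%:E X Y = X `^ C * Y `^ D.
Proof. by move=> X0 Y0; rewrite /power_mean mulr_gt0// eqxx. Qed.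

Lemma power_mean_max C D X Y : 0 < X -> 0 < Y ->
  power_mean C D +oo%E X Y = Num.max X Y.
Proof. by move=> X0 Y0; rewrite /power_mean mulr_gt0. Qed.

Lemma power_mean_min C D X Y : 0 < X -> 0 < Y ->
  power_mean C D -oo%E X Y = Num.min X Y.
Proof. by move=> X0 Y0; rewrite /power_mean mulr_gt0. Qed.

Lemma power_mean_ge0 C D beta X Y : 0 < X -> 0 < Y -> 0 <= power_mean C D beta X Y.
Proof.
move=> X0 Y0; rewrite /power_mean; case: ifP => // _; case: beta => [r| |].
- by case: ifP => _; rewrite ?mulr_ge0 ?powR_ge0.
- by rewrite le_max ltW.
- by rewrite le_min !ltW.
Qed.

Lemma power_mean_superhomogeneous C D beta : 0 < C -> 0 < D ->
  (beta = 0%E -> C + D = 1) -> superhomogeneous (power_mean C D beta).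
Proof.
move=> C0 D0 CD m X Y X' Y' m0 X0 Y0 XX' YY'.
have mX0 : 0 < m * X by rewrite mulr_gt0.
have mY0 : 0 < m * Y by rewrite mulr_gt0.
have X'0 : 0 < X' := lt_le_trans mX0 XX'.
have Y'0 : 0 < Y' := lt_le_trans mY0 YY'.
case: beta CD => [r| |] CD.
- have [r0|r0] := eqVneq r 0.
    rewrite r0 !power_mean_geom//.
    have {1}-> : m = m `^ C * m `^ D.
      rewrite -powRD ?CD ?powRr1 ?(ltW m0) ?r0//.
      by rewrite oner_eq0.
    rewrite mulrACA -!powRM ?(ltW m0) ?(ltW X0) ?(ltW Y0)//.
    by apply: ler_pM; rewrite ?powR_ge0//; apply: ge0_ler_powR; rewrite ?nnegrE//; exact: ltW.
  rewrite !power_mean_real//.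
  have -> : m * (C * X `^ r + D * Y `^ r) `^ r^-1 =
      (C * (m * X) `^ r + D * (m * Y) `^ r) `^ r^-1.
    rewrite !powRM ?(ltW m0) ?(ltW X0) ?(ltW Y0)// !(mulrCA _ (m `^ r)) -mulrDr.
    rewrite powRM ?powR_ge0// -?powRrM ?divff// ?powRr1 ?(ltW m0)//.
    by rewrite addr_ge0// mulr_ge0 ?powR_ge0// ltW.
  have sum_gt0 x y : 0 < x -> 0 < y -> 0 < C * x `^ r + D * y `^ r.
    by move=> x0 y0; rewrite addr_gt0// mulr_gt0// powR_gt0.
  move: r0; rewrite neq_lt => /orP[r0|r0].
    apply: lt0_ler_powR; [by rewrite invr_le0 ltW|exact: sum_gt0|].
    by apply: lerD; rewrite ler_pM2l//; apply: lt0_ler_powR => //; exact: ltW.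
  have s1 := sum_gt0 _ _ mX0 mY0; have s2 := sum_gt0 _ _ X'0 Y'0.
  apply: ge0_ler_powR; rewrite ?nnegrE ?invr_ge0 ?(ltW r0) ?(ltW s1) ?(ltW s2)//.
  by apply: lerD; rewrite ler_pM2l//; apply: ge0_ler_powR; rewrite ?nnegrE//; exact: ltW.
- rewrite !power_mean_max// maxr_pMr ?(ltW m0)//.
  by rewrite ge_max !le_max XX' YY' orbT.
- rewrite !power_mean_min// minr_pMr ?(ltW m0)//.
  by rewrite le_min !ge_min XX' YY' orbT.
Qed.

Lemma gt0_powRD (x r s : R) : 0 < x -> x `^ (r + s) = x `^ r * x `^ s.
Proof. by move=> x0; rewrite powRD// (gt_eqF x0) implybT. Qed.

Lemma powR_rescale X u S : 0 < X -> 0 < u -> X = X * u `^ (- S) * u `^ S.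
Proof. by move=> X0 u0; rewrite -mulrA -gt0_powRD// addNr powRr0 mulr1. Qed.

(** The mediant [(C u + D v) / (C P + D Q)] is at least the smaller of the two
fractions [u / P] and [v / Q]. *)
Lemma min_mediant_powR C D (P Q u v j S : R) : 0 < C -> 0 < D ->
  0 < P -> 0 < Q -> 0 < u -> 0 < v -> 0 < j -> j <= S -> u * Q <= v * P ->
  C `^ (S - j) * (P `^ (- j) * u `^ S) <=
  (C * P + D * Q) `^ (- j) * (C * u + D * v) `^ S.
Proof.
move=> C0 D0 P0 Q0 u0 v0 j0 jS uQ.
have cu0 : 0 < C * u by rewrite mulr_gt0.
have U0 : 0 < C * u + D * v by rewrite addr_gt0// mulr_gt0.
have W0 : 0 < C * P + D * Q by rewrite addr_gt0// mulr_gt0.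
have split x : 0 < x -> x `^ S = x `^ j * x `^ (S - j).
  by move=> x0; rewrite -gt0_powRD// addrC subrK.
have quot x y : 0 < x -> 0 < y -> x `^ (- j) * y `^ j = (y / x) `^ j.
  move=> x0 y0.
  by rewrite powRM ?invr_ge0 ?ltW// mulrC -(powR_inv1 (ltW x0)) -powRrM mulN1r.
rewrite (split _ u0) (split _ U0).
have -> : C `^ (S - j) * (P `^ (- j) * (u `^ j * u `^ (S - j))) =
    (u / P) `^ j * (C * u) `^ (S - j).
  by rewrite (powRM _ (ltW C0) (ltW u0)) -quot//; ring.
rewrite (mulrA (_ `^ (- j))) quot//.
have main : u / P <= (C * u + D * v) / (C * P + D * Q).
  rewrite ler_pdivrMr// mulrAC ler_pdivlMr// !mulrDr !mulrDl.
  by rewrite (mulrC u) -!mulrA (mulrC P) lerD2l (mulrCA u) ler_pM2l.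
apply: ler_pM; rewrite ?powR_ge0//.
  by apply: ge0_ler_powR; rewrite ?nnegrE ?divr_ge0//; exact: ltW.
apply: ge0_ler_powR; rewrite ?nnegrE ?subr_ge0 ?(ltW cu0) ?(ltW U0)//.
by rewrite lerDl mulr_ge0// ltW.
Qed.

(** Write [X] as [p^r^-1 u^S], with [p] the [r]-th power of the first argument of the
mean, and likewise [Y]; then apply [min_mediant_powR] to the smaller fraction.
At the threshold [S = - r^-1] the coefficients become 1 and the bound is the
minimum of [X] and [Y]. *)
Lemma admissible_min C D r X Y S : 0 < C -> 0 < D -> 0 < X -> 0 < Y ->
  r < 0 -> - r^-1 <= S ->
  admissible C D (power_mean C D r%:E) S X Y
    (Num.min (C `^ (S + r^-1) * X) (D `^ (S + r^-1) * Y)).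
Proof.
move=> C0 D0 X0 Y0 r0 jS u v u0 v0.
have rn : r != 0 by rewrite lt_eqF.
have j0 : 0 < - r^-1 by rewrite oppr_gt0 invr_lt0.
have P0 : 0 < X * u `^ (- S) by rewrite mulr_gt0// powR_gt0.
have Q0 : 0 < Y * v `^ (- S) by rewrite mulr_gt0// powR_gt0.
rewrite power_mean_real//; set P := X * _ in P0 *; set Q := Y * _ in Q0 *.
have XE : X = P `^ r `^ (- - r^-1) * u `^ S.
  by rewrite opprK -powRrM divff// powRr1 ?ltW// /P -powR_rescale.
have YE : Y = Q `^ r `^ (- - r^-1) * v `^ S.
  by rewrite opprK -powRrM divff// powRr1 ?ltW// /Q -powR_rescale.
rewrite -(opprK r^-1) {1}XE {1}YE.
have p0 : 0 < P `^ r by rewrite powR_gt0.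
have q0 : 0 < Q `^ r by rewrite powR_gt0.
have [uQ|uQ] := leP (u * Q `^ r) (v * P `^ r).
  by rewrite ge_min min_mediant_powR.
rewrite ge_min (addrC (C * P `^ r)) (addrC (C * u)).
by rewrite (min_mediant_powR D0 C0 q0 p0 v0 u0 j0 jS (ltW uQ)) orbT.
Qed.

Lemma admissible_minNy C D X Y S : 0 < C -> 0 < D -> 0 < X -> 0 < Y -> 0 <= S ->
  admissible C D (power_mean C D -oo%E) S X Y (Num.min (C `^ S * X) (D `^ S * Y)).
Proof.
move=> C0 D0 X0 Y0 S0 u v u0 v0.
rewrite power_mean_min ?mulr_gt0 ?powR_gt0//.
rewrite minr_pMl ?powR_ge0// le_min !ge_min.
have key c x z : 0 < c -> 0 < x -> 0 < z -> c * z <= C * u + D * v ->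
    c `^ S * x <= x * z `^ (- S) * (C * u + D * v) `^ S.
  move=> c0 x0 z0 cz; rewrite {1}(powR_rescale S x0 z0) mulrC -[leLHS]mulrA.
  rewrite ler_pM2l ?mulr_gt0 ?powR_gt0// -powRM ?(ltW z0) ?(ltW c0)// (mulrC z).
  have cz0 : 0 <= c * z by rewrite ltW// mulr_gt0.
  by apply: ge0_ler_powR; rewrite ?nnegrE// (le_trans cz0).
rewrite key//=; last by rewrite lerDl mulr_ge0// ltW.
by rewrite key ?orbT// lerDr mulr_ge0// ltW.
Qed.

Lemma admissible_positive C D r X Y S : 0 < C -> 0 < D -> 0 < X -> 0 < Y ->
  0 < r -> 0 <= S ->
  admissible C D (power_mean C D r%:E) S X Y
    (power_mean C D (S + r^-1)^-1%:E X Y).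
Proof.
move=> C0 D0 X0 Y0 r0 S0 u v u0 v0.
have k0 : 0 < r^-1 by rewrite invr_gt0.
have s0 : 0 < r^-1 + S by rewrite ltr_pwDl.
have P0 : 0 < X * u `^ (- S) by rewrite mulr_gt0// powR_gt0.
have Q0 : 0 < Y * v `^ (- S) by rewrite mulr_gt0// powR_gt0.
rewrite addrC !power_mean_real// ?gt_eqF ?invr_gt0// invrK.
have E x z : 0 < x -> 0 < z ->
    x `^ (r^-1 + S)^-1 = (x * z `^ (- S)) `^ r `^ (r^-1 / (r^-1 + S)) * z `^ (S / (r^-1 + S)).
  move=> x0 z0; rewrite {1}(powR_rescale S x0 z0) powRM ?powR_ge0 ?mulr_ge0 ?powR_ge0 ?(ltW x0)//.
  by rewrite -!powRrM mulrA divff ?gt_eqF// mul1r.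
rewrite (E _ _ X0 u0) (E _ _ Y0 v0).
by apply: powR_hoelder; rewrite ?powR_gt0 ?(ltW k0).
Qed.

Lemma admissible_maxy C D X Y S : 0 < C -> 0 < D -> 0 < X -> 0 < Y -> 0 < S ->
  admissible C D (power_mean C D +oo%E) S X Y (power_mean C D S^-1%:E X Y).
Proof.
move=> C0 D0 X0 Y0 S0 u v u0 v0.
have P0 : 0 < X * u `^ (- S) by rewrite mulr_gt0// powR_gt0.
have Q0 : 0 < Y * v `^ (- S) by rewrite mulr_gt0// powR_gt0.
rewrite power_mean_max// power_mean_real ?gt_eqF ?invr_gt0// invrK.
set m := Num.max _ _.
have m0 : 0 < m by rewrite lt_max P0.
have U0 : 0 < C * u + D * v by rewrite addr_gt0// mulr_gt0.
have -> : m * (C * u + D * v) `^ S = (m `^ S^-1 * (C * u + D * v)) `^ S.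
  by rewrite powRM ?powR_ge0 ?(ltW U0)// -powRrM mulVf ?gt_eqF// powRr1// ltW.
have key x z : 0 < x -> 0 < z -> x * z `^ (- S) <= m -> x `^ S^-1 <= m `^ S^-1 * z.
  move=> x0 z0 xm; rewrite {1}(powR_rescale S x0 z0).
  rewrite powRM ?powR_ge0 ?mulr_ge0 ?powR_ge0 ?(ltW x0)//.
  rewrite -(powRrM z) divff ?gt_eqF// powRr1 ?(ltW z0)// ler_pM2r//.
  apply: ge0_ler_powR; rewrite ?nnegrE ?invr_ge0 ?(ltW S0) ?(ltW m0)//.
  by rewrite mulr_ge0 ?powR_ge0 ?(ltW x0).
apply: ge0_ler_powR; rewrite ?nnegrE ?(ltW S0)//.
- by rewrite addr_ge0// mulr_ge0 ?powR_ge0 ?(ltW C0) ?(ltW D0).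
- by rewrite mulr_ge0 ?powR_ge0 ?(ltW U0).
by rewrite mulrDr !(mulrCA (m `^ _)); apply: lerD; rewrite ler_pM2l//;
  apply: key => //; rewrite /m le_max lexx ?orbT.
Qed.

Lemma admissible_geom C D X Y S : 0 < C -> 0 < D -> C + D = 1 -> 0 < X -> 0 < Y -> 0 <= S ->
  admissible C D (power_mean C D 0%:E) S X Y (power_mean C D 0%:E X Y).
Proof.
move=> C0 D0 CD X0 Y0 S0 u v u0 v0.
rewrite !power_mean_geom ?mulr_gt0 ?powR_gt0//.
have E c x z : 0 < x -> 0 < z ->
    x `^ c = (x * z `^ (- S)) `^ c * (z `^ c) `^ S.
  move=> x0 z0; have P0 : 0 <= x * z `^ (- S) by rewrite mulr_ge0 ?powR_ge0 ?(ltW x0).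
  rewrite {1}(powR_rescale S x0 z0) (@powRM _ _ _ c P0 (powR_ge0 z S)).
  by rewrite (powRAC z).
rewrite (E _ _ _ X0 u0) (E _ _ _ Y0 v0) mulrACA.
rewrite -(@powRM _ _ _ S (powR_ge0 u C) (powR_ge0 v D)).
rewrite ler_wpM2l ?mulr_ge0 ?powR_ge0//.
have AG : u `^ C * v `^ D <= C * u + D * v by apply: powR_amgm => //; exact: ltW.
have AG0 : 0 <= u `^ C * v `^ D by rewrite mulr_ge0 ?powR_ge0.
by apply: ge0_ler_powR; rewrite ?nnegrE// (le_trans AG0).
Qed.

(** Hoelder's inequality for the exponents [w] and [S], with both sums of negative
powers inverted. *)
Lemma powR_hoelder_negative C D X Y u v w S : 0 < C -> 0 < D -> 0 < X -> 0 < Y ->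
  0 < u -> 0 < v -> 0 < w -> 0 < S ->
  (C * X `^ (- w^-1) + D * Y `^ (- w^-1)) `^ (- w) <=
  (C * (X * u `^ (- S)) `^ (- (w + S)^-1) + D * (Y * v `^ (- S)) `^ (- (w + S)^-1))
    `^ (- (w + S)) * (C * u + D * v) `^ S.
Proof.
move=> C0 D0 X0 Y0 u0 v0 w0 S0.
have wS0 : 0 < w + S by rewrite addr_gt0.
have E x z : 0 < x -> 0 < z ->
   (x `^ (- w^-1)) `^ (w / (w + S)) * z `^ (S / (w + S)) =
   (x * z `^ (- S)) `^ (- (w + S)^-1).
  move=> x0 z0; rewrite powRM ?powR_ge0 ?(ltW x0)// -!powRrM.
  by rewrite mulrA !mulNr mulVf ?gt_eqF// mul1r mulrN opprK.
have X1 : 0 < X `^ (- w^-1) by rewrite powR_gt0.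
have Y1 : 0 < Y `^ (- w^-1) by rewrite powR_gt0.
have := powR_hoelder X1 Y1 u0 v0 C0 D0 (ltW w0) (ltW S0) wS0.
rewrite -(E _ _ X0 u0) -(E _ _ Y0 v0).
have G0 : 0 < C * X `^ (- w^-1) + D * Y `^ (- w^-1) by rewrite addr_gt0// mulr_gt0.
set H := C * (_ * _) + D * (_ * _).
have H0 : 0 < H by rewrite addr_gt0// !mulr_gt0// powR_gt0// powR_gt0.
rewrite (powRN _ w) (powRN _ (w + S)).
move: (powR_gt0 w G0) (powR_gt0 (w + S) H0).
move: (_ `^ w) (_ `^ (w + S)) (_ `^ S) => a b U a0 b0 hh.
by rewrite [b^-1 * _]mulrC ler_pdivlMr// [a^-1 * _]mulrC ler_pdivrMr// mulrC.
Qed.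

Lemma admissible_negative C D r X Y S : 0 < C -> 0 < D -> 0 < X -> 0 < Y ->
  r < 0 -> 0 < S -> S < - r^-1 ->
  admissible C D (power_mean C D r%:E) S X Y
    (power_mean C D (S + r^-1)^-1%:E X Y).
Proof.
move=> C0 D0 X0 Y0 r0 S0 Sj u v u0 v0.
have [w [w0 rE]] : exists w, 0 < w /\ r = - (w + S)^-1.
  exists (- r^-1 - S); split; first by rewrite subr_gt0.
  by rewrite subrK invrN opprK invrK.
have wS0 : 0 < w + S by rewrite addr_gt0.
have P0 : 0 < X * u `^ (- S) by rewrite mulr_gt0// powR_gt0.
have Q0 : 0 < Y * v `^ (- S) by rewrite mulr_gt0// powR_gt0.
rewrite {r r0 Sj}rE.
have -> : (S + (- (w + S)^-1)^-1)^-1 = - w^-1.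
  by rewrite invrN invrK opprD addrCA subrr addr0 invrN.
rewrite (power_mean_real _ _ _ X0 Y0) ?oppr_eq0 ?invr_eq0 ?gt_eqF//.
rewrite (power_mean_real _ _ _ P0 Q0) ?oppr_eq0 ?invr_eq0 ?gt_eqF//.
by rewrite !invrN !invrK; exact: powR_hoelder_negative.
Qed.

End power_mean_admissible.

(** * The Lp coefficients *)

Section Lp_coefficients.
Context {R : realType}.
Implicit Types p t l A B : R.

Lemma fine_hoelder_conjugateV p : 1 <= p ->
  fine (hoelder_conjugate p%:E)^-1%E = 1 - p^-1.
Proof.
move=> p1; have p0 : p != 0 by rewrite gt_eqF// (lt_le_trans ltr01).
have [->|pn1] := eqVneq p 1; first by rewrite hoelder_conjugate1 invey/= invr1 subrr.
rewrite /hoelder_conjugate /= eqe (negbTE p0) -EFinB inver subr_eq0 (negbTE pn1) -EFinM inver.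
rewrite mulf_eq0 invr_eq0 subr_eq0 (negbTE p0) (negbTE pn1)/=.
by rewrite invf_div mulrBl divff// mul1r.
Qed.

Lemma Lp_CE p t l : 1 <= p -> Lp_C p l t = (1 - t) `^ p^-1 * (1 - l) `^ (1 - p^-1).
Proof. by move=> p1; rewrite /Lp_C fine_hoelder_conjugateV. Qed.

Lemma Lp_DE p t l : 1 <= p -> Lp_D p l t = t `^ p^-1 * l `^ (1 - p^-1).
Proof. by move=> p1; rewrite /Lp_D fine_hoelder_conjugateV. Qed.

Lemma Lp_C_gt0 p t l : t < 1 -> l < 1 -> 0 < Lp_C p l t.
Proof. by move=> t1 l1; rewrite mulr_gt0// powR_gt0// subr_gt0. Qed.

Lemma Lp_D_gt0 p t l : 0 < t -> 0 < l -> 0 < Lp_D p l t.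
Proof. by move=> t0 l0; rewrite mulr_gt0// powR_gt0. Qed.

Lemma Lp_C_diag p t : 1 <= p -> t < 1 -> Lp_C p t t = 1 - t.
Proof.
move=> p1 t1; have t1' : 0 < 1 - t by rewrite subr_gt0.
by rewrite Lp_CE// -gt0_powRD// (addrC p^-1) subrK powRr1// ltW.
Qed.

Lemma Lp_D_diag p t : 1 <= p -> 0 < t -> Lp_D p t t = t.
Proof. by move=> p1 t0; rewrite Lp_DE// -gt0_powRD// (addrC p^-1) subrK powRr1// ltW. Qed.

(** The case of equality in Hoelder's inequality: [l] is the share of
[t * B ^ p] in the total. *)
Lemma Lp_coefficients_optimal p t A B : 1 <= p -> 0 < t < 1 -> 0 < A -> 0 < B ->
  exists2 l, 0 < l < 1 &
    Lp_C p l t * A + Lp_D p l t * B = ((1 - t) * A `^ p + t * B `^ p) `^ p^-1.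
Proof.
move=> p1 /andP[t0 t1] A0 B0.
have p0 : p != 0 by rewrite gt_eqF// (lt_le_trans ltr01).
have t1' : 0 < 1 - t by rewrite subr_gt0.
have a0 : 0 < (1 - t) * A `^ p by rewrite mulr_gt0// powR_gt0.
have b0 : 0 < t * B `^ p by rewrite mulr_gt0// powR_gt0.
set a := (1 - t) * _ in a0 *; set b := t * _ in b0 *.
have s0 : 0 < a + b by rewrite addr_gt0.
have key c x y : 0 < c -> 0 < x -> y = c * x `^ p ->
    c `^ p^-1 * (y / (a + b)) `^ (1 - p^-1) * x = y / (a + b) `^ (1 - p^-1).
  move=> c0 x0 ->; set z := c * x `^ p.
  have z0 : 0 < z by rewrite mulr_gt0// powR_gt0.
  have xE : c `^ p^-1 * x = z `^ p^-1.
    by rewrite powRM ?powR_ge0 ?(ltW c0)// -powRrM divff// powRr1// ltW.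
  rewrite powRM ?invr_ge0 ?(ltW z0) ?(ltW s0)// mulrAC xE mulrA -gt0_powRD// (addrC p^-1) subrK.
  rewrite powRr1 ?(ltW z0)//; congr (_ * _).
  by rewrite -(powR_inv1 (ltW s0)) -powRrM mulN1r powRN.
exists (b / (a + b)).
  by rewrite divr_gt0//= ltr_pdivrMr// mul1r ltrDr.
have -> : Lp_C p (b / (a + b)) t = (1 - t) `^ p^-1 * (a / (a + b)) `^ (1 - p^-1).
  by rewrite Lp_CE//; congr (_ * _ `^ _); field; rewrite gt_eqF.
have kA := key _ _ _ t1' A0 (erefl a).
have kB := key _ _ _ t0 B0 (erefl b).
rewrite Lp_DE//; apply: (etrans (congr2 +%R kA kB)).
rewrite -mulrDl; clearbody a b; move: (a + b) s0 => s s0.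
rewrite -{1}[s](powRr1 (ltW s0)) -powRB ?(gt_eqF s0) ?implybT//.
by rewrite subKr.
Qed.

End Lp_coefficients.

(** * The two regimes *)

Section conclusions.
Context {R : realType}.

(** Regimes: geometric mean for [beta = 0]; Hoelder for [beta > 0], with [+oo] as
limit; reversed Hoelder for [- S^-1 < beta < 0]; minimum at the threshold, where
[gamma] is [-oo]. *)
Lemma admissible_gamma n (alpha : 'I_n -> R) (beta : \bar R) (C D X Y : R) :
  let S := \sum_(i < n) (alpha i)^-1 in
  0 < C -> 0 < D -> (beta = 0%E -> C + D = 1) -> 0 < X -> 0 < Y -> 0 < S ->
  ((- S^-1)%:E <= beta)%E ->
  admissible C D (power_mean C D beta) S X Y (power_mean C D (gamma alpha beta) X Y).
Proof.
move=> S C0 D0 CD X0 Y0 S0 Sb; rewrite /gamma -/S.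
case: beta CD Sb => [r| |] CD; last by rewrite leeNy_eq.
- rewrite lee_fin eqe /recip => Sr.
  have [r0|rn] := eqVneq r 0; first by rewrite r0; apply: admissible_geom; rewrite ?CD ?r0// ltW.
  have [r0|r0|r0] := ltgtP r 0; last by rewrite r0 eqxx in rn.
    have rS : S <= - r^-1.
      rewrite lerNr -(invrK S) -invrN.
      by rewrite lef_nV2 ?negrE// oppr_lt0 invr_gt0.
    have [s0|s0] := eqVneq (S + r^-1) 0.
      have := admissible_min C0 D0 X0 Y0 r0 (_ : - r^-1 <= S).
      rewrite s0 !powRr0 !mul1r -(power_mean_min C D X0 Y0) => h; apply: h.
      by move/eqP: s0; rewrite addr_eq0 => /eqP ->.
    apply: admissible_negative => //.
    by rewrite lt_neqAle rS andbT -addr_eq0.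
  rewrite gt_eqF ?addr_gt0 ?invr_gt0//.
  exact: admissible_positive (ltW S0).
- by move=> _ /=; rewrite addr0 gt_eqF//; exact: admissible_maxy.
Qed.

Lemma admissible_min_gamma n (alpha : 'I_n -> R) (beta : \bar R) (C D X Y : R) :
  let S := \sum_(i < n) (alpha i)^-1 in
  0 < C -> 0 < D -> 0 < X -> 0 < Y -> 0 < S -> (beta < (- S^-1)%:E)%E ->
  admissible C D (power_mean C D beta) S X Y
    (Num.min (C `^ recip (gamma alpha beta) * X) (D `^ recip (gamma alpha beta) * Y)).
Proof.
move=> S C0 D0 X0 Y0 S0; rewrite /gamma -/S.
case: beta => [r| |]//.
- rewrite lte_fin eqe /recip => rS.
  have r0 : r < 0 by rewrite (lt_trans rS)// oppr_lt0 invr_gt0.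
  have rS' : - r^-1 < S.
    rewrite ltrNl -(invrK S) -invrN.
    by rewrite ltf_nV2 ?negrE// oppr_lt0 invr_gt0.
  rewrite lt_eqF// gt_eqF; last by rewrite -ltrBlDr sub0r.
  by rewrite invrK; apply: admissible_min => //; exact: ltW.
- move=> _ /=; rewrite addr0 gt_eqF//= invrK.
  by apply: admissible_minNy => //; exact: ltW.
Qed.

End conclusions.

Theorem theorem1p2 (R : realType) (n : nat) (n_ge1 : (1 <= n)%N)
  (p t : R) (p_ge1 : 1 <= p) (t_in01 : 0 < t < 1)
  (alpha : 'I_n -> R) (alpha_in01 : forall i, 0 < alpha i <= 1)
  (beta : \bar R)
  (f g h : n.-tuple R -> R)
  (f_ge0 : forall x, orthant R n x -> 0 <= f x)
  (g_ge0 : forall x, orthant R n x -> 0 <= g x)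
  (h_ge0 : forall x, orthant R n x -> 0 <= h x)
  (f_bounded : [bounded f x | x in orthant R n])
  (g_bounded : [bounded g x | x in orthant R n])
  (h_bounded : [bounded h x | x in orthant R n])
  (f_integrable : (lebesgue R n).-integrable (orthant R n) (EFin \o f))
  (g_integrable : (lebesgue R n).-integrable (orthant R n) (EFin \o g))
  (h_integrable : (lebesgue R n).-integrable (orthant R n) (EFin \o h))
  (f_support : has_bounded_support f)
  (g_support : has_bounded_support g)
  (h_support : has_bounded_support h)
  (fgh : forall x y : n.-tuple R, orthant R n x -> orthant R n y -> 0 < f x * g y ->
     forall l : R, 0 < l < 1 ->
     Lp_mean p t l beta (f x) (g y) <=
     h [tuple Lp_mean p t l (alpha i)%:E (tnth x i) (tnth y i) | i < n]) :
  let S := \sum_(i < n) (alpha i)^-1 in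
  let gam := gamma alpha beta in
  let If := \int[lebesgue R n]_(x in orthant R n) f x in
  let Ig := \int[lebesgue R n]_(x in orthant R n) g x in
  let Ih := \int[lebesgue R n]_(x in orthant R n) h x in
  (((- S^-1)%:E <= beta)%E -> mean t (p%:E * gam)%E If Ig <= Ih) /\
  ((beta < (- S^-1)%:E)%E ->
     (ereal_sup [set (Num.min (Lp_C p l t `^ recip gam * If)
                              (Lp_D p l t `^ recip gam * Ig))%R%:E
                | l in [set l : R | (0 < l < 1)%R]] <= Ih%:E)%E).
Proof.
move=> S gam If Ig Ih.
have [t0 t1] := andP t_in01.
have p0 : 0 < p := lt_le_trans ltr01 p_ge1.
have S0 : 0 < S.
  have al0 i : 0 < (alpha i)^-1 by rewrite invr_gt0; case/andP: (alpha_in01 i).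
  rewrite /S (bigD1 (Ordinal n_ge1))//=; apply: ltr_pwDl; first exact: al0.
  by apply: sumr_ge0 => i _; exact: ltW.
have If0 : 0 <= If by apply: Rintegral_ge0.
have Ig0 : 0 <= Ig by apply: Rintegral_ge0.
have Ih0 : 0 <= Ih by apply: Rintegral_ge0.
have core l k : 0 < l < 1 -> (beta = 0%E -> Lp_C p l t + Lp_D p l t = 1) ->
    0 < If -> 0 < Ig ->
    admissible (Lp_C p l t) (Lp_D p l t) (Lp_mean p t l beta) S If Ig k -> k <= Ih.
  move=> l01 CD Ifp Igp; have [l0 l1] := andP l01.
  have C0 := Lp_C_gt0 p t1 l1; have D0 := Lp_D_gt0 p t0 l0.
  apply: (admissible_integral_lebesgue C0 D0 (@power_mean_ge0 _ _ _ _) _ alpha_in01) => //.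
    exact: power_mean_superhomogeneous.
  move=> x y x0 y0 fx gy.
  have -> : coord_mean (Lp_C p l t) (Lp_D p l t) alpha x y =
      [tuple Lp_mean p t l (alpha i)%:E (tnth x i) (tnth y i) | i < n].
    apply: eq_from_tnth => i; rewrite !tnth_mktuple /Lp_mean power_mean_real//.
    by rewrite gt_eqF//; case/andP: (alpha_in01 i).
  by apply: fgh => //; [move=> i; exact: ltW|move=> i; exact: ltW|exact: mulr_gt0].
(* From here on only the signs of the three integrals and [core] are used. *)
clearbody If Ig Ih.
have zero_or_pos (x : R) : 0 <= x -> x = 0 \/ 0 < x.
  by rewrite le_eqVlt => /predU1P[<-|]; [left|right].
have min0l a b : a = 0 -> Num.min a b <= Ih by move=> ->; rewrite ge_min Ih0.
have min0r a b : b = 0 -> Num.min a b <= Ih by move=> ->; rewrite ge_min Ih0 orbT.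
split=> [Sb|Sb].
- have [IfIg|IfIg] := ltP 0 (If * Ig); last by rewrite /mean /power_mean ltNge IfIg.
  have Ifp : 0 < If by rewrite lt_def If0 andbT; apply: contraTneq IfIg => ->; rewrite mul0r ltxx.
  have Igp : 0 < Ig by rewrite lt_def Ig0 andbT; apply: contraTneq IfIg => ->; rewrite mulr0 ltxx.
  have adm l : 0 < l < 1 -> (beta = 0%E -> Lp_C p l t + Lp_D p l t = 1) ->
      power_mean (Lp_C p l t) (Lp_D p l t) gam If Ig <= Ih.
    move=> l01 CD; have [l0 l1] := andP l01.
    apply: (core l _ l01 CD Ifp Igp); apply: admissible_gamma => //.
    - exact: Lp_C_gt0.
    - exact: Lp_D_gt0.
  have diag : Lp_C p t t + Lp_D p t t = 1 by rewrite Lp_C_diag// Lp_D_diag// subrK.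
  move: adm; rewrite /gam /gamma -/S.
  have [b0|bn] := eqVneq beta 0%E.
    by move/(_ t t_in01 (fun=> diag)); rewrite mule0 Lp_C_diag// Lp_D_diag.
  have [s0|sn] := eqVneq (S + recip beta) 0.
    by move/(_ t t_in01 (fun=> diag)); rewrite gt0_muleNy ?lte_fin.
  set s := S + recip beta in sn *.
  have A0 : 0 < If `^ s^-1 by rewrite powR_gt0.
  have B0 : 0 < Ig `^ s^-1 by rewrite powR_gt0.
  have [l l01 lopt] := Lp_coefficients_optimal p_ge1 t_in01 A0 B0.
  have CD : beta = 0%E -> Lp_C p l t + Lp_D p l t = 1 by move=> b0; rewrite b0 eqxx in bn.
  have sV : s^-1 != 0 by rewrite invr_eq0.
  have psV : p * s^-1 != 0 by rewrite mulf_neq0// gt_eqF.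
  have powE x : x `^ (p * s^-1) = (x `^ s^-1) `^ p by rewrite mulrC powRrM.
  have powVE x : x `^ (p * s^-1)^-1 = (x `^ p^-1) `^ s^-1^-1 by rewrite invfM powRrM.
  move/(_ l l01 CD); rewrite (power_mean_real _ _ sV Ifp Igp) lopt -EFinM.
  by rewrite /mean (power_mean_real _ _ psV Ifp Igp) powVE (powE If) (powE Ig).
- apply: ge_ereal_sup => _ [l /= l01 <-]; rewrite lee_fin.
  have [l0 l1] := andP l01.
  have [If_0|Ifp] := zero_or_pos _ If0; first by apply: min0l; rewrite If_0 mulr0.
  have [Ig_0|Igp] := zero_or_pos _ Ig0; first by apply: min0r; rewrite Ig_0 mulr0.
  have C0 := Lp_C_gt0 p t1 l1; have D0 := Lp_D_gt0 p t0 l0.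
  apply: (core l _ l01 _ Ifp Igp); last exact: admissible_min_gamma.
  move=> b0; move: Sb; rewrite b0 lte_fin oppr_gt0 invr_lt0 ltNge.
  by rewrite (ltW S0).
Qed.
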